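(* Let $p,q\in\mathbb N$ with $1\le p\le q-1$ and $\gcd(p,q)=1$, and let $\omega=e^{2\pi i p/q}$. The $C^*$-algebra $\mathcal A_{p/q}\subset\mathcal B(H_q)$, with its generators $U,V$, is the universal $C^*$-algebra in $\mathfrak C_{p/q}$. That is, $\mathcal A_{p/q}\in\mathfrak C_{p/q}$, and for every Hilbert space $H_1$ and every $C^*$-algebra $\mathcal A_1\in\mathfrak C_{p/q}$ generated by unitary operators $U_1,V_1\in\mathcal B(H_1)$ satisfying $U_1V_1=\omega V_1U_1$, there exists a $*$-homomorphism $\Psi:\mathcal A_{p/q}\to\mathcal A_1$ with $\Psi(U)=U_1$ and $\Psi(V)=V_1$.
   Context: $\mathcal B(H)$ is the $C^*$-algebra of bounded operators on a complex Hilbert space $H$. The $C^*$-algebra generated by a subset $S\subset\mathcal B(H)$ is the smallest norm-closed, adjoint-closed subalgebra of $\mathcal B(H)$ containing $S$. $\mathfrak C_{p/q}$ is the class of all $C^*$-algebras generated by a pair of unitary operators $U,V\in\mathcal B(H)$, for some Hilbert space $H$, satisfying $UV=\omega VU$. Definition of $\mathcal A_{p/q}$: Let $\mathcal M_q$ be the algebra of complex $q\times q$ matrices and $e_1,\dots,e_q$ the standard basis of $\mathbb C^q$. Let $U_0,V_0\in\mathcal M_q$ be given by $U_0e_1=e_q$, $U_0e_j=e_{j-1}$ for $2\le j\le q$, and $V_0=\mathrm{diag}(1,\omega,\omega^2,\dots,\omega^{q-1})$. Let $H_q=L^2(\mathbb R^2,\mathbb C^q)$. Let $\mathcal P_q$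 be the $C^*$-algebra of continuous $a:\mathbb R^2\to\mathcal M_q$ satisfying $a(x_1,x_2)=a(x_1+q,x_2)=a(x_1,x_2+q)$ for all $(x_1,x_2)\in\mathbb R^2$, regarded as a $C^*$-subalgebra of $\mathcal B(H_q)$ by $(av)(x)=a(x)v(x)$. Define $U,V\in\mathcal P_q$ by $U(x_1,x_2)=e^{2\pi i x_1/q}U_0$ and $V(x_1,x_2)=e^{2\pi i x_2/q}V_0$. Then $\mathcal A_{p/q}$ is the $C^*$-subalgebra of $\mathcal P_q$ generated by $\{U,V\}$. *)

(* Defs.v *)
From HB Require Import structures.
From mathcomp Require Import all_boot all_order all_algebra.
From mathcomp Require Import complex ring_quotient ring.
From mathcomp Require Import all_classical all_reals all_analysis.
From mathcomp Require Import measurable_realfun.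

Set Implicit Arguments.
Unset Strict Implicit.
Unset Printing Implicit Defensive.

Import Order.TTheory GRing.Theory Num.Theory.
Import numFieldNormedType.Exports.

Local Open Scope ring_scope.
Local Open Scope complex_scope.
Local Open Scope classical_set_scope.
Local Open Scope quotient_scope.


(* Inner products are linear in the first variable. *)
HB.mixin Record isPreHilbert (R : realType) H & GRing.Lmodule R[i] H := {
  inner : H -> H -> R[i];
  inner_linearl : forall (y : H) (a : R[i]) (x z : H),
    inner (a *: x + z) y = a * inner x y + inner z y;
  inner_conj : forall x y : H, inner y x = (inner x y)^*;
  inner_ge0 : forall x : H, 0 <= inner x x;
  inner_eq0 : forall x : H, inner x x = 0 -> x = 0
}.

#[short(type="prehilbertType")]
HB.structure Definition PreHilbert (R : realType) :=
  {H of GRing.Lmodule R[i] H & isPreHilbert R H}.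

Definition hnorm (R : realType) (H : prehilbertType R) (x : H) : R :=
  Num.sqrt (complex.Re (inner x x)).

HB.mixin Record PreHilbert_isHilbert (R : realType) H & PreHilbert R H := {
  hilbert_complete : forall u : nat -> H,
    (forall e : R, 0 < e -> exists N, forall m n, (N <= m)%N -> (N <= n)%N ->
       hnorm (u m - u n) < e) ->
    exists l : H, forall e : R, 0 < e -> exists N, forall n, (N <= n)%N ->
       hnorm (u n - l) < e
}.

#[short(type="hilbertType")]
HB.structure Definition Hilbert (R : realType) :=
  {H of PreHilbert R H & PreHilbert_isHilbert R H}.

(* Subsets of B(H) are sets of functions H -> H all of whose members are bounded
   operators; sum and scaling of functions are pointwise, the product is \o. *)
Section Operators.
Context {R : realType} {H : hilbertType R}.
Implicit Types (S T U : H -> H) (A : set (H -> H)).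

Definition bounded_op T : Prop :=
  linear T /\ exists M : R, forall x, hnorm (T x) <= M * hnorm x.

Definition opnorm T : R := sup [set hnorm (T x) | x in [set x | hnorm x <= 1]].

(* [adjoint T S] reads S = T^*: such an S is unique, and it exists for every
   bounded T by the Riesz representation theorem. *)
Definition adjoint T S : Prop := forall x y, inner (T x) y = inner x (S y).

Definition unitary_op U : Prop :=
  bounded_op U /\ exists S, [/\ adjoint U S, U \o S = idfun & S \o U = idfun].

Definition cstar_subalgebra A : Prop :=
  [/\ A `<=` bounded_op,
      A 0,
      forall S T, A S -> A T -> A (S + T),
      forall (c : R[i]) T, A T -> A (c *: T)
    & forall S T, A S -> A T -> A (S \o T)] /\
  [/\ forall T S, A T -> adjoint T S -> A S
    & forall T, bounded_op T ->
        (forall e : R, 0 < e -> exists2 S, A S & opnorm (T - S) < e) -> A T].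

Definition cstar_generated (X : set (H -> H)) : set (H -> H) :=
  smallest cstar_subalgebra X.

(* A is the C*-algebra generated by unitaries U, V subject to U V = w V U;
   [rotation_class w] is the class of all C*-algebras arising in this way. *)
Definition generating_pair (w : R[i]) A U V : Prop :=
  [/\ unitary_op U, unitary_op V, U \o V = w *: (V \o U)
    & A = cstar_generated [set U; V]].

Definition rotation_class (w : R[i]) A : Prop :=
  exists U V, generating_pair w A U V.

End Operators.

(* Only the values of Psi on A matter. *)
Definition star_homomorphism (R : realType) (H1 H2 : hilbertType R)
    (A : set (H1 -> H1)) (B : set (H2 -> H2))
    (Psi : (H1 -> H1) -> (H2 -> H2)) : Prop :=
  [/\ set_fun A B Psi,
      forall S T, A S -> A T -> Psi (S + T) = Psi S + Psi T,
      forall (c : R[i]) T, A T -> Psi (c *: T) = c *: Psi T,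
      forall S T, A S -> A T -> Psi (S \o T) = Psi S \o Psi T
    & forall T S, A T -> adjoint T S -> adjoint (Psi T) (Psi S)].

Section L2Complete.
Context d (T : measurableType d) (R : realType).
Variable mu : {measure set T -> \bar R}.
Implicit Types f g : T -> R.

Lemma Lfun2P f : f \in Lfun mu 2%:E <->
  measurable_fun setT f /\ (\int[mu]_x ((f x) ^+ 2)%:E < +oo)%E.
Proof.
have E : (\int[mu]_x ((f x) ^+ 2)%:E = \int[mu]_x `|(f x)%:E| `^ 2)%E.
  apply: eq_integral => x _ /=.
  by rewrite -real_normK ?num_real// powR_mulrn.
split=> [|[mf fi]].
  move=> /[dup] /Lfun2_integrable_sqr /integrableP[_ fi].
  rewrite inE => /andP[]; rewrite !inE/= => mf _; split=> //.
  apply: le_lt_trans fi; rewrite le_eqVlt; apply/orP; left; apply/eqP.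
  by apply: eq_integral => x _; rewrite /= ger0_norm ?sqr_ge0.
rewrite inE; apply/andP; rewrite !inE/=; split=> //.
by rewrite /finite_norm unlock -E poweR_lty.
Qed.

Lemma measurable_sqr f : measurable_fun setT f ->
  measurable_fun setT (EFin \o (fun x => (f x) ^+ 2)).
Proof. by move=> mf; apply/measurable_EFinP; exact: measurable_funX. Qed.

Lemma fast_cvg_ae (u : nat -> T -> R) :
  (forall n, measurable_fun setT (u n)) ->
  (forall n, \int[mu]_x ((u n.+1 x - u n x) ^+ 2)%:E <= (8^-1 ^+ n)%:E)%E ->
  {ae mu, forall x, cvgn (u ^~ x)}.
Proof.
move=> mu_ ule.
pose d_ n x := ((4 ^+ n) * (u n.+1 x - u n x) ^+ 2)%:E.
have d0 n x : (0 <= d_ n x)%E.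
  by rewrite lee_fin mulr_ge0 ?sqr_ge0 ?exprn_ge0.
have md n : measurable_fun setT (d_ n).
  apply/measurable_EFinP; apply: measurable_funM => //.
  by apply: measurable_funX; apply: measurable_funB.
pose S x := (\sum_(0 <= n <oo) d_ n x)%E.
have mS : measurable_fun setT S.
  by apply: ge0_emeasurable_sum => // n x _ _; exact: d0.
have Sfin : (\int[mu]_x S x < +oo)%E.
  rewrite integral_nneseries//.
  apply: (@le_lt_trans _ _ (\sum_(0 <= n <oo) (2^-1 ^+ n)%:E)%E).
    apply: lee_nneseries => n _; first by move=> _; exact: integral_ge0.
    rewrite /d_; under eq_integral do rewrite EFinM.
    rewrite ge0_integralZl//=.
    - apply: (@le_trans _ _ ((4 ^+ n)%:E * (8^-1 ^+ n)%:E)%E).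
        by apply: lee_pmul => //; apply: integral_ge0 => x _ /=; rewrite lee_fin sqr_ge0.
      by rewrite -EFinM lee_fin -exprMn (_ : 4 * 8^-1 = 2^-1 :> R)//; field.
    - by apply: measurable_sqr; exact: measurable_funB.
    - by move=> x _; rewrite lee_fin sqr_ge0.
  have : (fun n => \sum_(0 <= k < n) (2^-1 ^+ k)%:E)%E @ \oo --> (2%:R : R)%:E.
    apply: cvg_trans (_ : (fun n => (series (geometric 1 (2^-1 : R)) n)%:E) @ \oo --> _).
      apply: near_eq_cvg; near=> n; rewrite /series/= -sumEFin.
      by apply: eq_bigr => k _; rewrite mul1r.
    apply/fine_cvgP; split; first by near=> n.
    have := @cvg_geometric_series R 1 2^-1.
    rewrite (_ : 1 / (1 - 2^-1) = 2%:R) ; last by field.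
    by apply; rewrite gtr0_norm ?invr_gt0// invf_lt1 ?ltr1n.
  by move=> /cvg_lim -> //; rewrite ltry.
have /(integrable_ae measurableT) : mu.-integrable setT S.
  apply/integrableP; split=> //.
  by under eq_integral do rewrite gee0_abs ?nneseries_ge0//.
apply: filterS => x /(_ Logic.I) Sx.
pose s := Num.sqrt (fine (S x)).
have S0 : (0 <= S x)%E by rewrite nneseries_ge0.
have dle n : `|u n.+1 x - u n x| <= s * 2^-1 ^+ n.
  have h : (d_ n x <= S x)%E.
    apply: le_trans (nneseries_lim_ge n.+1 _); last by [].
    by rewrite big_nat_recr//= leeDr// sume_ge0.
  have : 4 ^+ n * (u n.+1 x - u n x) ^+ 2 <= fine (S x).
    by rewrite -lee_fin fineK.
  rewrite (_ : 4 = 2 ^+ 2 :> R); last by rewrite -natrX.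
  rewrite -exprM mulnC exprM -exprMn => /ler_wsqrtr.
  rewrite sqrtr_sqr normrM ger0_norm ?exprn_ge0//.
  by rewrite exprVn ler_pdivlMr ?exprn_gt0// mulrC.
have : cvgn (series (fun n => u n.+1 x - u n x)).
  apply: normed_cvg.
  apply: (@series_le_cvg _ _ (geometric s 2^-1)) => //=.
  - by move=> n; rewrite mulr_ge0 ?sqrtr_ge0 ?exprn_ge0 ?invr_ge0.
  - by apply: is_cvg_geometric_series; rewrite gtr0_norm ?invr_gt0// invf_lt1 ?ltr1n.
move=> /cvg_ex[l hl]; apply/cvg_ex; exists (l + u 0%N x).
apply: cvg_trans (_ : (fun n => series (fun n => u n.+1 x - u n x) n + u 0%N x) @ \oo --> _).
  by apply: near_eq_cvg; near=> n; rewrite /series/= telescope_sumr// subrK.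
exact: cvgD hl (cvg_cst _).
Unshelve. all: by end_near. Qed.

(* Riesz-Fischer *)
Lemma Lfun2_complete (u : nat -> T -> R) : (forall n, u n \in Lfun mu 2%:E) ->
  (forall e : R, 0 < e -> exists N, forall m n, (N <= m)%N -> (N <= n)%N ->
    (\int[mu]_x ((u m x - u n x) ^+ 2)%:E <= e%:E)%E) ->
  exists2 v, v \in Lfun mu 2%:E &
  forall e : R, 0 < e -> exists N, forall n, (N <= n)%N ->
    (\int[mu]_x ((u n x - v x) ^+ 2)%:E <= e%:E)%E.
Proof.
move=> Lu cu.
have mu_ n : measurable_fun setT (u n) by have /Lfun2P[] := Lu n.
have /choice[N hN] : forall k, exists N, forall m n, (N <= m)%N -> (N <= n)%N ->
    (\int[mu]_x ((u m x - u n x) ^+ 2)%:E <= (8^-1 ^+ k)%:E)%E.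
  by move=> k; apply: cu; rewrite exprn_gt0 ?invr_gt0.
pose phi k := (k + \sum_(j < k.+1) N j)%N.
have phiS k : (phi k <= phi k.+1)%N.
  by rewrite /phi [X in (_ <= _ + X)%N]big_ord_recr/= leq_add ?leq_addr.
have Nphi k : (N k <= phi k)%N.
  by rewrite /phi big_ord_recr/= addnA leq_addl.
have aec : {ae mu, forall x, cvgn ((fun k => u (phi k)) ^~ x)}.
  apply: fast_cvg_ae => // k; apply: hN; last exact: Nphi.
  exact: leq_trans (Nphi k) (phiS k).
pose v x := fine (limn_esup (fun k => (u (phi k) x)%:E)).
have mv : measurable_fun setT v.
  apply: measurableT_comp => //; apply: measurable_fun_limn_esup => k.
  exact/measurable_EFinP.
have aev : {ae mu, forall x, u (phi k) x @[k --> \oo] --> v x}.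
  apply: filterS aec => x /cvg_ex[l hl].
  suff -> : v x = l by [].
  rewrite /v (_ : limn_esup _ = l%:E)//.
  have /cvg_limn_einf_sup[_ ->//] : (u (phi k) x)%:E @[k --> \oo] --> l%:E.
  by apply/fine_cvgP; split; [near=> k|].
have key (e : R) : 0 < e -> exists N, forall n, (N <= n)%N ->
    (\int[mu]_x ((u n x - v x) ^+ 2)%:E <= e%:E)%E.
  move=> e0; have [M hM] := cu e e0; exists M => n Mn.
  have mF k : measurable_fun setT (EFin \o (fun x => (u n x - u (phi k) x) ^+ 2)).
    by apply: measurable_sqr; exact: measurable_funB.
  rewrite (@ge0_ae_eq_integral _ _ _ mu setT _
    (fun x => limn_einf (fun k => ((u n x - u (phi k) x) ^+ 2)%:E)))//.
  - apply: le_trans (fatou mu measurableT mF _) _.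
      by move=> k x _; rewrite lee_fin sqr_ge0.
    rewrite limn_einf_lim; apply: lime_le; first exact: is_cvg_einfs.
    near=> k; apply: (@le_trans _ _ (\int[mu]_x ((u n x - u (phi k) x) ^+ 2)%:E)%E).
      by apply: ereal_inf_lbound; exists k => //=.
    apply: hM => //; near: k; exists M => // k /= Mk.
    by rewrite /phi (leq_trans Mk)// leq_addr.
  - by apply: measurable_sqr; exact: measurable_funB.
  - rewrite (_ : (fun _ => _) = (fun x => - limn_esup (fun k => - ((u n x - u (phi k) x) ^+ 2)%:E))%E); last first.
      by apply/funext => x; rewrite /limn_einf.
    apply: measurableT_comp => //.
    apply: (@measurable_fun_limn_esup _ _ _ _ (fun k x => - ((u n x - u (phi k) x) ^+ 2)%:E)%E) => k.
    by apply: measurableT_comp => //; exact: mF.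
  - by move=> x _; rewrite lee_fin sqr_ge0.
  - move=> x _; rewrite limn_einf_lim; apply: lime_ge; first exact: is_cvg_einfs.
    by near=> k; apply: le_ereal_inf_tmp => _ [m /= _ <-]; rewrite lee_fin sqr_ge0.
  - apply: filterS aev => x hx _.
    suff /cvg_limn_einf_sup[-> _] : ((u n x - u (phi k) x) ^+ 2)%:E @[k --> \oo] --> ((u n x - v x) ^+ 2)%:E by [].
    apply/fine_cvgP; split; first by near=> k.
    have h : (u n x - u (phi k) x) @[k --> \oo] --> u n x - v x by apply: cvgB => //; exact: cvg_cst.
    by rewrite /comp /= expr2; under eq_fun do rewrite expr2; apply: cvgM.
exists v => //.
have [M /(_ M (leqnn M)) hM] := key 1 ltr01.
have -> : v = u M - (u M \- v) by apply/funext => x; rewrite !fctE /=; ring.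
have [] := @GRing.submod_closedB _ _ _ (Lfun_submod_closed mu (lee1n 2)).
move=> _; apply => //; apply/Lfun2P; split; first exact: measurable_funB.
exact: le_lt_trans hM (ltry _).
Unshelve. all: by end_near. Qed.
End L2Complete.

Section L2.
Context d (T : measurableType d) (R : realType).
Variables (mu : {measure set T -> \bar R}) (q : nat).
Local Notation fn := (T -> 'cV[R[i]]_q).

(* A C^q-valued function is square integrable iff the real and imaginary parts
   of all its coordinates are. *)
Definition sqint : {pred fn} :=
  mem [set f : fn | forall i, (fun x => complex.Re (f x i 0)) \in Lfun mu 2%:E /\
                              (fun x => complex.Im (f x i 0)) \in Lfun mu 2%:E].

Lemma sqintP (f : fn) : reflect
  (forall i, (fun x => complex.Re (f x i 0)) \in Lfun mu 2%:E /\
             (fun x => complex.Im (f x i 0)) \in Lfun mu 2%:E) (f \in sqint).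
Proof. by apply: (iffP idP); rewrite inE. Qed.

Lemma Lfun2Z a (u : T -> R) :
  u \in Lfun mu 2%:E -> (fun x => a * u x) \in Lfun mu 2%:E.
Proof.
move=> Lu; have [_ h] := GRing.submod_closed_semi (Lfun_submod_closed mu (lee1n 2)).
exact: (h a _ Lu).
Qed.

Lemma Lfun2D (u v : T -> R) : u \in Lfun mu 2%:E -> v \in Lfun mu 2%:E ->
  (fun x => u x + v x) \in Lfun mu 2%:E.
Proof.
move=> Lu Lv; have [_ h] := Lfun_submod_closed mu (lee1n 2).
by have := h 1 _ _ Lu Lv; rewrite scale1r.
Qed.

Lemma Lfun2B (u v : T -> R) : u \in Lfun mu 2%:E -> v \in Lfun mu 2%:E ->
  (fun x => u x - v x) \in Lfun mu 2%:E.
Proof.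
move=> Lu Lv; have /(_ u _ Lu) := Lfun2D; apply.
by under eq_fun do rewrite -mulN1r; exact: Lfun2Z.
Qed.

Lemma Lfun20 : (fun=> 0) \in Lfun mu 2%:E.
Proof. by have [] := Lfun_submod_closed mu (lee1n 2). Qed.

Lemma sqint_submod_closed : submod_closed sqint.
Proof.
split=> [|a f g /sqintP hf /sqintP hg].
  apply/sqintP => i.
  have E x : (0 : fn) x i 0 = 0 by rewrite mxE.
  by split; under eq_fun do rewrite E /=; exact: Lfun20.
apply/sqintP => i; have [f1 f2] := hf i; have [g1 g2] := hg i.
have E x : (a *: f + g) x i 0 =
    (complex.Re a * complex.Re (f x i 0) - complex.Im a * complex.Im (f x i 0) + complex.Re (g x i 0)) +i*
    (complex.Re a * complex.Im (f x i 0) + complex.Im a * complex.Re (f x i 0) + complex.Im (g x i 0)).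
  by rewrite !fctE !mxE; case: a (f x i 0) (g x i 0) => [a1 a2] [b1 b2] [c1 c2].
split; under eq_fun do rewrite E /=.
  by apply: Lfun2D => //; apply: Lfun2B; exact: Lfun2Z.
by apply: Lfun2D => //; apply: Lfun2D; exact: Lfun2Z.
Qed.

HB.instance Definition _ :=
  GRing.isSubmodClosed.Build R[i] fn sqint sqint_submod_closed.

Record sqint_fun := SqintFun { sqint_val :> fn; _ : sqint_val \in sqint }.

HB.instance Definition _ := [isSub for sqint_val].
HB.instance Definition _ := [Choice of sqint_fun by <:].
HB.instance Definition _ := [SubChoice_isSubLmodule of sqint_fun by <:].

Definition ae_null : {pred sqint_fun} :=
  mem [set f : sqint_fun | {ae mu, forall x, f x = 0}].

Lemma ae_nullP (f : sqint_fun) :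
  reflect {ae mu, forall x, f x = 0} (f \in ae_null).
Proof. by apply: (iffP idP); rewrite inE. Qed.

Lemma ae_null_submod_closed : submod_closed ae_null.
Proof.
split=> [|a f g /ae_nullP hf /ae_nullP hg]; apply/ae_nullP.
  by apply: aeW => x.
by apply: filterS2 hf hg => x /= fx gx; rewrite !fctE fx gx scaler0 addr0.
Qed.

HB.instance Definition _ :=
  GRing.isSubmodClosed.Build R[i] sqint_fun ae_null ae_null_submod_closed.

(* Classes, modulo equality almost everywhere, of square integrable functions. *)
Definition L2 : Type := Quotient.quot ae_null.

HB.instance Definition _ := Choice.on L2.
HB.instance Definition _ := GRing.Zmodule.on L2.
HB.instance Definition _ := EqQuotient.on L2.
HB.instance Definition _ := ZmodQuotient.on L2.


Lemma L2_eqP (f g : sqint_fun) :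
  reflect {ae mu, forall x, f x = g x} (\pi_L2 f == \pi_L2 g).
Proof.
rewrite -Quotient.idealrBE; apply: (iffP (ae_nullP _)); apply: filterS => x.
  by move=> /= /eqP; rewrite !fctE subr_eq0 => /eqP.
by move=> /= fg; rewrite !fctE fg subrr.
Qed.

Lemma repr_pi_ae (f : sqint_fun) : {ae mu, forall x, repr (\pi_L2 f) x = f x}.
Proof. by apply/L2_eqP; rewrite reprK. Qed.

Definition L2_scale (a : R[i]) (u : L2) : L2 := \pi_L2 (a *: repr u).

Lemma pi_scale a f : \pi_L2 (a *: f) = L2_scale a (\pi_L2 f).
Proof.
apply/eqP/L2_eqP; apply: filterS (repr_pi_ae f) => x /= fx.
by rewrite !fctE fx.
Qed.

Lemma L2_scaleA a b u : L2_scale a (L2_scale b u) = L2_scale (a * b) u.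
Proof. by elim/quotW: u => f; rewrite -(pi_scale b f) -(pi_scale a) -(pi_scale (a * b) f) scalerA. Qed.

Lemma L2_scale1 : left_id 1 L2_scale.
Proof. by elim/quotW=> f; rewrite -pi_scale scale1r. Qed.

Lemma L2_scaleDr : right_distributive L2_scale +%R.
Proof.
move=> a; elim/quotW=> f; elim/quotW=> g.
by rewrite -pi_addr -(pi_scale a (f + g)) -(pi_scale a f) -(pi_scale a g) scalerDr pi_addr.
Qed.

Lemma L2_scaleDl u : {morph L2_scale^~ u : a b / a + b}.
Proof.
by move=> a b /=; elim/quotW: u => f; rewrite -(pi_scale (a + b) f) -(pi_scale a f) -(pi_scale b f) scalerDl pi_addr.
Qed.

HB.instance Definition _ := GRing.Zmodule_isLmodule.Build R[i] L2
  L2_scaleA L2_scale1 L2_scaleDr L2_scaleDl.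

Lemma pi_linear a f g : \pi_L2 (a *: f + g) = a *: \pi_L2 f + \pi_L2 g.
Proof. by rewrite pi_addr pi_scale. Qed.

Definition cintegral (h : T -> R[i]) : R[i] :=
  (\int[mu]_x complex.Re (h x)) +i* (\int[mu]_x complex.Im (h x)).

Definition cintegrable (h : T -> R[i]) : Prop :=
  mu.-integrable setT (EFin \o (fun x => complex.Re (h x))) /\
  mu.-integrable setT (EFin \o (fun x => complex.Im (h x))).

Lemma integrableDr (u v : T -> R) : mu.-integrable setT (EFin \o u) ->
  mu.-integrable setT (EFin \o v) -> mu.-integrable setT (EFin \o (fun x => u x + v x)).
Proof. by move=> iu iv; apply: eq_integrable (integrableD measurableT iu iv). Qed.

Lemma integrableZr a (u : T -> R) : mu.-integrable setT (EFin \o u) ->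
  mu.-integrable setT (EFin \o (fun x => a * u x)).
Proof. by move=> iu; apply: eq_integrable (integrableZl measurableT a iu). Qed.

Lemma integrableBr (u v : T -> R) : mu.-integrable setT (EFin \o u) ->
  mu.-integrable setT (EFin \o v) -> mu.-integrable setT (EFin \o (fun x => u x - v x)).
Proof. by move=> iu iv; apply: eq_integrable (integrableB measurableT iu iv). Qed.

Lemma cintegrable_lin a h k : cintegrable h -> cintegrable k ->
  cintegrable (fun x => a * h x + k x).
Proof.
move=> [h1 h2] [k1 k2]; case: a => a1 a2.
have E x : (a1 +i* a2) * h x + k x =
    (a1 * complex.Re (h x) - a2 * complex.Im (h x) + complex.Re (k x)) +i*
    (a1 * complex.Im (h x) + a2 * complex.Re (h x) + complex.Im (k x)).
  by case: (h x) (k x) => [? ?] [? ?].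
split; under eq_fun do rewrite E /=.
  by apply: integrableDr => //; apply: integrableBr; exact: integrableZr.
by apply: integrableDr => //; apply: integrableDr; exact: integrableZr.
Qed.

Lemma cintegral_lin a h k : cintegrable h -> cintegrable k ->
  cintegral (fun x => a * h x + k x) = a * cintegral h + cintegral k.
Proof.
move=> [h1 h2] [k1 k2]; case: a => a1 a2.
have E x : (a1 +i* a2) * h x + k x =
    (a1 * complex.Re (h x) - a2 * complex.Im (h x) + complex.Re (k x)) +i*
    (a1 * complex.Im (h x) + a2 * complex.Re (h x) + complex.Im (k x)).
  by case: (h x) (k x) => [? ?] [? ?].
rewrite /cintegral; apply/eqP; rewrite eq_complex /=; apply/andP; split; apply/eqP.
  under eq_Rintegral do rewrite E /=.
  rewrite RintegralD ?RintegralB ?RintegralZl//.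
  - exact: integrableZr.
  - exact: integrableZr.
  - by apply: integrableBr; exact: integrableZr.
under eq_Rintegral do rewrite E /=.
rewrite RintegralD ?RintegralD ?RintegralZl//.
- exact: integrableZr.
- exact: integrableZr.
- by apply: integrableDr; exact: integrableZr.
Qed.

Lemma cintegral_conj h : cintegrable h -> cintegral (fun x => (h x)^*) = (cintegral h)^*.
Proof.
move=> [h1 h2]; apply/eqP; rewrite eq_complex /=; apply/andP; split; apply/eqP.
  by apply: eq_Rintegral => x _; case: (h x).
rewrite -mulN1r -RintegralZl//; apply: eq_Rintegral => x _.
by case: (h x) => ? ? /=; rewrite mulN1r.
Qed.

Lemma cintegral_ae h k : cintegrable h -> cintegrable k ->
  {ae mu, forall x, h x = k x} -> cintegral h = cintegral k.
Proof.
move=> [/integrableP[h1 _] /integrableP[h2 _]] [/integrableP[k1 _] /integrableP[k2 _]] hk.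
rewrite /cintegral /Rintegral; congr (_ +i* _); congr fine;
  by apply: ae_eq_integral => //; apply: filterS hk => x /= ->.
Qed.

Definition pointwise_dot (f g : fn) (x : T) : R[i] :=
  \sum_(i < q) f x i 0 * (g x i 0)^*.

Lemma dot_integrable (f g : sqint_fun) : cintegrable (pointwise_dot f g).
Proof.
rewrite /pointwise_dot.
have : forall i, cintegrable (fun x => f x i 0 * (g x i 0)^*).
  move=> i; have /sqintP/(_ i)[f1 f2] := valP f; have /sqintP/(_ i)[g1 g2] := valP g.
  have E x : f x i 0 * (g x i 0)^* =
    (complex.Re (f x i 0) * complex.Re (g x i 0) + complex.Im (f x i 0) * complex.Im (g x i 0)) +i*
    (complex.Im (f x i 0) * complex.Re (g x i 0) - complex.Re (f x i 0) * complex.Im (g x i 0)).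
    by case: (f x i 0) (g x i 0) => [a b] [c e]; apply/eqP; rewrite eq_complex/=; apply/andP; split; apply/eqP; ring.
  split; under eq_fun do rewrite E /=.
    by apply: integrableDr; apply/Lfun1_integrable; exact: Lfun2_mul_Lfun1.
  by apply: integrableBr; apply/Lfun1_integrable; exact: Lfun2_mul_Lfun1.
move=> H; elim: (index_enum _) => [|i s IH].
  have E (x : T) : \sum_(i <- [::]) f x i 0 * (g x i 0)^* = 0 by rewrite big_nil.
  by split; under eq_fun do rewrite E /=; exact: integrable0.
have E (x : T) : \sum_(i <- i :: s) f x i 0 * (g x i 0)^* =
    1 * (f x i 0 * (g x i 0)^*) + \sum_(i <- s) f x i 0 * (g x i 0)^*.
  by rewrite big_cons mul1r.
by under eq_fun do rewrite E; exact: cintegrable_lin.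
Qed.

Definition L2_inner (u v : L2) : R[i] :=
  cintegral (pointwise_dot (repr u) (repr v)).

Lemma L2_inner_pi (f g : sqint_fun) :
  L2_inner (\pi_L2 f) (\pi_L2 g) = cintegral (pointwise_dot f g).
Proof.
apply: cintegral_ae; [exact: dot_integrable..|].
apply: filterS2 (repr_pi_ae f) (repr_pi_ae g) => x fx gx.
by rewrite /pointwise_dot fx gx.
Qed.

Lemma L2_inner_linearl (v : L2) a (u w : L2) :
  L2_inner (a *: u + w) v = a * L2_inner u v + L2_inner w v.
Proof.
elim/quotW: u => f; elim/quotW: w => h; elim/quotW: v => g.
rewrite -pi_linear !L2_inner_pi -cintegral_lin; [|exact: dot_integrable..].
congr cintegral; apply/funext => x; rewrite /pointwise_dot mulr_sumr -big_split.
by apply: eq_bigr => i _; rewrite /= !fctE !mxE mulrDl mulrA.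
Qed.

Lemma L2_inner_conj (u v : L2) : L2_inner v u = (L2_inner u v)^*.
Proof.
elim/quotW: u => f; elim/quotW: v => g.
rewrite !L2_inner_pi -cintegral_conj; last exact: dot_integrable.
congr cintegral; apply/funext => x; rewrite /pointwise_dot rmorph_sum.
by apply: eq_bigr => i _; rewrite rmorphM /= conjcK mulrC.
Qed.

Definition normsq (f : fn) x : R :=
  \sum_(i < q) (complex.Re (f x i 0) ^+ 2 + complex.Im (f x i 0) ^+ 2).

Lemma dotE f x : pointwise_dot f f x = (normsq f x) +i* 0.
Proof.
rewrite /pointwise_dot /normsq [RHS](rmorph_sum (real_complex R)).
apply: eq_bigr => i _; rewrite -sqr_normc -add_Re2_Im2.
by [].
Qed.

Lemma normsq_ge0 f x : 0 <= normsq f x.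
Proof. by apply: sumr_ge0 => i _; rewrite addr_ge0 ?sqr_ge0. Qed.

Lemma normsq_integrable (f : sqint_fun) :
  mu.-integrable setT (EFin \o (normsq f)).
Proof.
have [+ _] := dot_integrable f f.
by congr (mu.-integrable _ _); apply/funext => x /=; rewrite dotE.
Qed.

Lemma L2_inner_self (f : sqint_fun) :
  L2_inner (\pi_L2 f) (\pi_L2 f) = (\int[mu]_x normsq f x) +i* 0.
Proof.
rewrite L2_inner_pi /cintegral; congr (_ +i* _).
  by apply: eq_Rintegral => x _; rewrite dotE.
rewrite -[RHS](_ : \int[mu]_x (cst 0 x) = 0).
  by apply: eq_Rintegral => x _; rewrite dotE.
by rewrite /Rintegral integral0.
Qed.

Lemma L2_inner_ge0 (u : L2) : 0 <= L2_inner u u.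
Proof.
elim/quotW: u => f; rewrite L2_inner_self lecE /= eqxx /=.
by apply: Rintegral_ge0 => x _; exact: normsq_ge0.
Qed.

Lemma L2_inner_eq0 (u : L2) : L2_inner u u = 0 -> u = 0.
Proof.
elim/quotW: u => f; rewrite L2_inner_self => -[/= f0].
rewrite -(pi_zeror (s := L2)).
apply/eqP/L2_eqP.
have /integrableP[mf fi] := normsq_integrable f.
have : (\int[mu]_x `|(EFin \o normsq f) x| = 0)%E.
  transitivity (\int[mu]_x (normsq f x)%:E)%E.
    by apply: eq_integral => x _ /=; rewrite ger0_norm ?normsq_ge0.
  by rewrite -[LHS]fineK ?(integral_fune_fin_num _ (normsq_integrable f))//; congr EFin.
move=> /(ae_eq_integral_abs mu measurableT mf).1; apply: filterS => x /(_ Logic.I) /= [/eqP].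
rewrite psumr_eq0; last by move=> i _; rewrite addr_ge0 ?sqr_ge0.
move=> /allP h; apply/colP => i; have := h i (mem_index_enum _).
rewrite paddr_eq0 ?sqr_ge0 ?sqrf_eq0// => /andP[/eqP r0 /eqP i0]; rewrite mxE.
by apply/eqP; rewrite eq_complex r0 i0 /= eqxx.
Qed.

HB.instance Definition _ := isPreHilbert.Build R L2
  L2_inner_linearl L2_inner_conj L2_inner_ge0 L2_inner_eq0.

Lemma hnorm_L2 (f : sqint_fun) :
  ((hnorm (\pi_L2 f) ^+ 2)%:E = \int[mu]_x (normsq f x)%:E)%E.
Proof.
rewrite /hnorm sqr_sqrtr.
  by rewrite [inner _ _]L2_inner_self /= fineK// integral_fune_fin_num//; exact: normsq_integrable.
by rewrite [inner _ _]L2_inner_self /=; apply: Rintegral_ge0 => x _; exact: normsq_ge0.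
Qed.


Lemma normsq_bound (f : sqint_fun) (e : R) i : hnorm (\pi_L2 f) < Num.sqrt e ->
  (\int[mu]_x ((complex.Re (f x i 0)) ^+ 2)%:E <= e%:E /\
   \int[mu]_x ((complex.Im (f x i 0)) ^+ 2)%:E <= e%:E)%E.
Proof.
move=> h; have e0 : 0 < e by rewrite -sqrtr_gt0 (le_lt_trans _ h) ?sqrtr_ge0.
have le1 : (\int[mu]_x (normsq f x)%:E <= e%:E)%E.
  by rewrite -hnorm_L2 lee_fin -(sqr_sqrtr (ltW e0)) ler_sqr ?nnegrE ?sqrtr_ge0 ?(ltW h).
have /integrableP[mN _] := normsq_integrable f.
have /sqintP/(_ i)[/Lfun2P[f1 _] /Lfun2P[f2 _]] := valP f.
have leN x : complex.Re (f x i 0) ^+ 2 + complex.Im (f x i 0) ^+ 2 <= normsq f x.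
  by rewrite /normsq (bigD1 i)//= lerDl sumr_ge0// => j _; rewrite addr_ge0 ?sqr_ge0.
split; apply: le_trans le1; apply: ge0_le_integral => //.
- by move=> x _; rewrite lee_fin sqr_ge0.
- exact: measurable_sqr.
- by move=> x _; rewrite lee_fin (le_trans _ (leN x))// lerDl sqr_ge0.
- by move=> x _; rewrite lee_fin sqr_ge0.
- exact: measurable_sqr.
- by move=> x _; rewrite lee_fin (le_trans _ (leN x))// lerDr sqr_ge0.
Qed.

Lemma L2_complete (u : nat -> L2) :
  (forall e : R, 0 < e -> exists N, forall m n, (N <= m)%N -> (N <= n)%N ->
     hnorm (u m - u n) < e) ->
  exists l : L2, forall e : R, 0 < e -> exists N, forall n, (N <= n)%N ->
     hnorm (u n - l) < e.
Proof.
move=> cu; pose f n : sqint_fun := repr (u n).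
have uE n : u n = \pi_L2 (f n) by rewrite reprK.
have piB (g h : sqint_fun) : \pi_L2 g - \pi_L2 h = \pi_L2 (g - h).
  by rewrite pi_addr pi_oppr.
have cf i (e : R) : 0 < e -> exists N, forall m n, (N <= m)%N -> (N <= n)%N ->
    (\int[mu]_x ((complex.Re (f m x i 0) - complex.Re (f n x i 0)) ^+ 2)%:E <= e%:E /\
     \int[mu]_x ((complex.Im (f m x i 0) - complex.Im (f n x i 0)) ^+ 2)%:E <= e%:E)%E.
  move=> e0; have [N hN] := cu (Num.sqrt e) (etrans (sqrtr_gt0 e) e0).
  exists N => m n Nm Nn; have := hN m n Nm Nn.
  rewrite !uE piB => /(@normsq_bound _ _ i)[h1 h2]; split.
    apply: le_trans h1; rewrite le_eqVlt; apply/orP; left; apply/eqP.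
    apply: eq_integral => x _; congr (_%:E); congr (_ ^+ 2).
    by rewrite /= !fctE !mxE; case: (f m x i 0) (f n x i 0) => [? ?] [? ?].
  apply: le_trans h2; rewrite le_eqVlt; apply/orP; left; apply/eqP.
  apply: eq_integral => x _; congr (_%:E); congr (_ ^+ 2).
  by rewrite /= !fctE !mxE; case: (f m x i 0) (f n x i 0) => [? ?] [? ?].
have Lf n i : (fun x => complex.Re (f n x i 0)) \in Lfun mu 2%:E /\
              (fun x => complex.Im (f n x i 0)) \in Lfun mu 2%:E.
  by have /sqintP := valP (f n); apply.
have /choice[V hV] : forall i, exists v, v \in Lfun mu 2%:E /\
    forall e : R, 0 < e -> exists N, forall n, (N <= n)%N ->
    (\int[mu]_x ((complex.Re (f n x i 0) - v x) ^+ 2)%:E <= e%:E)%E.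
  move=> i; have [|e /(cf i)[N hN]|v Lv hv] :=
      @Lfun2_complete _ _ _ mu (fun n x => complex.Re (f n x i 0)).
  - by move=> n; have [] := Lf n i.
  - by exists N => m n Nm Nn; have [] := hN m n Nm Nn.
  - by exists v.
have /choice[W hW] : forall i, exists v, v \in Lfun mu 2%:E /\
    forall e : R, 0 < e -> exists N, forall n, (N <= n)%N ->
    (\int[mu]_x ((complex.Im (f n x i 0) - v x) ^+ 2)%:E <= e%:E)%E.
  move=> i; have [|e /(cf i)[N hN]|v Lv hv] :=
      @Lfun2_complete _ _ _ mu (fun n x => complex.Im (f n x i 0)).
  - by move=> n; have [] := Lf n i.
  - by exists N => m n Nm Nn; have [] := hN m n Nm Nn.
  - by exists v.
pose g0 : fn := fun x => \col_i (V i x +i* W i x).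
have g0S : g0 \in sqint.
  apply/sqintP => i; have [LV _] := hV i; have [LW _] := hW i.
  have E x : g0 x i 0 = V i x +i* W i x by rewrite mxE.
  by split; under eq_fun do rewrite E /=.
pose g := SqintFun g0S.
exists (\pi_L2 g) => e e0.
pose e' := e ^+ 2 / (2 * q%:R + 1).
have e'0 : 0 < e' by rewrite divr_gt0 ?exprn_gt0// ltr_wpDl// mulr_ge0 ?ler0n.
have /choice[N hN] : forall i, exists N, forall n, (N <= n)%N ->
    (\int[mu]_x ((complex.Re (f n x i 0) - V i x) ^+ 2)%:E <= e'%:E /\
     \int[mu]_x ((complex.Im (f n x i 0) - W i x) ^+ 2)%:E <= e'%:E)%E.
  move=> i; have [_ /(_ _ e'0)[N1 h1]] := hV i; have [_ /(_ _ e'0)[N2 h2]] := hW i.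
  exists (maxn N1 N2) => n; rewrite geq_max => /andP[n1 n2].
  by split; [exact: h1|exact: h2].
exists (\max_i N i)%N => n Nn; rewrite uE piB.
rewrite -ltr_sqr ?nnegrE ?sqrtr_ge0 ?(ltW e0)// -lte_fin hnorm_L2.
have E1 i x : complex.Re ((f n - g) x i 0) = complex.Re (f n x i 0) - V i x.
  by rewrite /= !fctE !mxE; case: (f n x i 0).
have E2 i x : complex.Im ((f n - g) x i 0) = complex.Im (f n x i 0) - W i x.
  by rewrite /= !fctE !mxE; case: (f n x i 0).
have m1 i : measurable_fun setT (fun x => complex.Re (f n x i 0) - V i x).
  have [/Lfun2P[? _] _] := Lf n i; have [/Lfun2P[? _] _] := hV i.
  exact: measurable_funB.
have m2 i : measurable_fun setT (fun x => complex.Im (f n x i 0) - W i x).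
  have [_ /Lfun2P[? _]] := Lf n i; have [/Lfun2P[? _] _] := hW i.
  exact: measurable_funB.
apply: (@le_lt_trans _ _ (\sum_(i < q) (e' + e')%:E)%E); last first.
  rewrite sumEFin lte_fin sumr_const card_ord -mulr_natr /e'.
  have -> : (e ^+ 2 / (2 * q%:R + 1) + e ^+ 2 / (2 * q%:R + 1)) * q%:R
     = e ^+ 2 * (2 * q%:R) / (2 * q%:R + 1) by ring.
  rewrite ltr_pdivrMr ?ltr_wpDl// ?mulr_ge0 ?ler0n//.
  by rewrite ltr_pM2l ?exprn_gt0// ltrDl.
under eq_integral do rewrite /normsq -sumEFin.
rewrite ge0_integral_sum//; last 2 first.
- move=> i; apply/measurable_EFinP; apply: measurable_funD.
    by under eq_fun do rewrite E1; exact: measurable_funX.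
  by under eq_fun do rewrite E2; exact: measurable_funX.
- by move=> i x _; rewrite lee_fin addr_ge0 ?sqr_ge0.
apply: lee_sum => i _.
under eq_integral do rewrite E1 E2 EFinD.
rewrite ge0_integralD//=.
- have [h1 h2] := hN i n (leq_trans (leq_bigmax i) Nn).
  by rewrite EFinD leeD.
- by move=> x _; rewrite lee_fin sqr_ge0.
- exact: measurable_sqr.
- by move=> x _; rewrite lee_fin sqr_ge0.
- exact: measurable_sqr.
Qed.

HB.instance Definition _ := PreHilbert_isHilbert.Build R L2 L2_complete.

End L2.

Definition expi (R : realType) (t : R) : R[i] := cos t +i* sin t.

Section RotationAlgebra.
Context (R : realType) (p q : nat).
Local Notation plane := (measurableTypeR R * measurableTypeR R)%type.

Definition plane_measure : {measure set plane -> \bar R} :=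
  (lebesgue_measure \x lebesgue_measure)%E.

Definition Hq : hilbertType R := L2 plane_measure q.

(* The multiplication operator (a v)(x) = a(x) v(x). [insubd 0] bundles the
   product with the proof that it is square integrable; its default value 0 is
   reached only if it is not, which cannot happen for a continuous periodic. *)
Definition mulop (a : R * R -> 'M[R[i]]_q) (v : Hq) : Hq :=
  \pi_(L2 plane_measure q)
    (insubd (0 : sqint_fun plane_measure q)
       (fun x : plane => a x *m (repr v : sqint_fun plane_measure q) x)).

(* The topology on the entries is that of the modulus, carried by R[i]^o. *)
Definition periodic_matrix_fun : set (R * R -> 'M[R[i]]_q) :=
  [set a | continuous (a : R * R -> 'M[R[i]^o]_q) /\
     forall x1 x2, a (x1, x2) = a (x1 + q%:R, x2) /\
                   a (x1, x2) = a (x1, x2 + q%:R)].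

Definition Pq : set (Hq -> Hq) := mulop @` periodic_matrix_fun.

Definition omega : R[i] := expi (2 * pi * p%:R / q%:R).

(* Basis vectors are numbered from 0, so the j-th column is the basis vector
   of index j - 1 mod q. *)
Definition U0 : 'M[R[i]]_q := \matrix_(i, j) (i == ord_pred j)%:R.

Definition V0 : 'M[R[i]]_q := diag_mx (\row_j omega ^+ j).

Definition Uq : Hq -> Hq :=
  mulop (fun x => expi (2 * pi * x.1 / q%:R) *: U0).

Definition Vq : Hq -> Hq :=
  mulop (fun x => expi (2 * pi * x.2 / q%:R) *: V0).

Definition rotation_algebra : set (Hq -> Hq) :=
  smallest [set B | cstar_subalgebra B /\ B `<=` Pq] [set Uq; Vq].

End RotationAlgebra.

Arguments Uq R q _ : clear implicits.
Arguments Vq R p q _ : clear implicits.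
Arguments rotation_algebra R p q _ : clear implicits.

(* Main.v *)
(* Let U1, V1 on H satisfy U1 V1 = w V1 U1. For n >= 1 send xi in H to the
   function on the torus with values in C^q (x) H
     x |-> n^-1 sum_(k1, k2 < n) x1^k1 x2^k2 U0^k1 V0^k2 e_0 (x) V1^-k2 U1^-k1 xi.
   By Parseval this map J_n is isometric. Multiplying J_n xi by the symbol
   x1 U0 of U shifts the summation index, so it agrees with J_n (U1 xi) up to the
   boundary of the box, an error of norm O(n^(-1/2)); the same holds for V. Thus
   the pairs (a, T1) of a matrix function a and an operator T1 such that
   a J_n - J_n T1 -> 0 strongly contain the generators, are closed under the
   algebraic operations and uniform limits, and satisfy |T1| <= sup |a(x)|
   because J_n is isometric. Finally sup |a(x)| is the norm of multiplication by
   a on L2, by testing on small squares. Hence T1 is determined by the operator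
   of multiplication by a, and this correspondence is defined on a C*-algebra
   containing U and V. The torus is replaced by a finite grid, on which Parseval
   is an identity between finite sums. *)
From HB Require Import structures.
Require Import Defs.
From mathcomp Require Import all_boot all_order all_algebra.
From mathcomp Require Import complex ring lra.
From mathcomp Require Import all_classical all_reals all_analysis.
From mathcomp Require Import measurable_realfun.

Set Implicit Arguments.
Unset Strict Implicit.
Unset Printing Implicit Defensive.

Import Order.TTheory GRing.Theory Num.Theory.
Import numFieldNormedType.Exports.
Import ComplexField.Normc.

Local Open Scope ring_scope.
Local Open Scope complex_scope.
Local Open Scope classical_set_scope.
Local Open Scope quotient_scope.

(** * Hilbert spaces and bounded operators *)

(** The heart of the matter is the estimate |T1| <= |T|, to be had without any spectral theory of
    the pair U1, V1. The factor V1^-k2 U1^-k1 in J_n is chosen so that applying U1 or V1 to xi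
    cancels one of the inverses. The order of the two inverses matters: moving V1 to the left of
    U1^-k1 costs the phase w^-k1, and on the component e_i, which occurs only when q divides k1 + i,
    this phase equals w^i because w^q = 1. That is the diagonal entry of V0, and it explains why the
    coefficients take values in C^q. Two obstacles shape the rest. Strong convergence does not pass
    to adjoints, so adjoints are carried along explicitly and started from the generators, where
    unitarity of the symbols gives them. And the rotation algebra is the smallest C*-algebra inside
    [Pq], whereas the class of the theorem refers to the smallest C*-algebra of bounded operators;
    the two are identified by running the correspondence with [Hq] itself as the target space. *)

Lemma conjcM (R : realType) (a b : R[i]) : (a * b)^*%C = a^*%C * b^*%C.
Proof. exact: rmorphM. Qed.

Section PreHilbertTheory.
Context {R : realType} {H : prehilbertType R}.
Implicit Types (x y z : H) (a : R[i]).

Lemma innerDl x y z : inner (x + y) z = inner x z + inner y z.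
Proof. by rewrite -[x in LHS]scale1r inner_linearl mul1r. Qed.

Lemma inner0l z : inner 0 z = 0 :> R[i].
Proof. by apply: (addrI (inner 0 z)); rewrite -innerDl !addr0. Qed.

Lemma innerZl a x z : inner (a *: x) z = a * inner x z.
Proof. by rewrite -[a *: x]addr0 inner_linearl inner0l addr0. Qed.

Lemma innerNl x z : inner (- x) z = - inner x z.
Proof. by rewrite -scaleN1r innerZl mulN1r. Qed.

Lemma innerBl x y z : inner (x - y) z = inner x z - inner y z.
Proof. by rewrite innerDl innerNl. Qed.

Lemma inner_suml I (r : seq I) (P : pred I) (F : I -> H) z :
  inner (\sum_(i <- r | P i) F i) z = \sum_(i <- r | P i) inner (F i) z.
Proof.
by apply: (big_morph (fun x => inner x z)) => [x y|]; rewrite ?innerDl ?inner0l.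
Qed.

Lemma innerDr z x y : inner z (x + y) = inner z x + inner z y.
Proof. by rewrite inner_conj innerDl rmorphD/= -!inner_conj. Qed.

Lemma inner0r z : inner z 0 = 0 :> R[i].
Proof. by rewrite inner_conj inner0l conjc0. Qed.

Lemma innerZr z a x : inner z (a *: x) = a^*%C * inner z x.
Proof. by rewrite inner_conj innerZl rmorphM/= -!inner_conj. Qed.

Lemma innerNr z x : inner z (- x) = - inner z x.
Proof. by rewrite inner_conj innerNl rmorphN/= -!inner_conj. Qed.

Lemma innerBr z x y : inner z (x - y) = inner z x - inner z y.
Proof. by rewrite innerDr innerNr. Qed.

Lemma inner_sumr I (r : seq I) (P : pred I) (F : I -> H) z :
  inner z (\sum_(i <- r | P i) F i) = \sum_(i <- r | P i) inner z (F i).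
Proof.
by apply: (big_morph (inner z)) => [x y|]; rewrite ?innerDr ?inner0r.
Qed.

Lemma hnorm_ge0 x : 0 <= hnorm x.
Proof. exact: sqrtr_ge0. Qed.

Lemma inner_self x : inner x x = ((hnorm x) ^+ 2)%:C.
Proof.
have := inner_ge0 x; rewrite lecE /= => /andP[/eqP h h'].
rewrite /hnorm sqr_sqrtr// (complexE (inner x x)) h.
by rewrite mulr0 addr0.
Qed.

Lemma sqr_hnorm x : hnorm x ^+ 2 = complex.Re (inner x x).
Proof. by rewrite inner_self. Qed.

Lemma hnorm0 : hnorm (0 : H) = 0.
Proof. by rewrite /hnorm inner0l sqrtr0. Qed.

Lemma hnorm_eq0 x : hnorm x = 0 -> x = 0.
Proof. by move=> h; apply: inner_eq0; rewrite inner_self h expr0n. Qed.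

Lemma normc_ge0 a : 0 <= normc a.
Proof. by case: a => ? ?; exact: sqrtr_ge0. Qed.

Lemma normc_real (r : R) : normc r%:C = `|r|.
Proof. by rewrite /normc/= expr0n addr0 sqrtr_sqr. Qed.

Lemma mulc_conj a : a * a^*%C = (normc a ^+ 2)%:C.
Proof. by rewrite -sqr_normc rmorphXn. Qed.

Lemma sqr_normcE a : normc a ^+ 2 = complex.Re a ^+ 2 + complex.Im a ^+ 2.
Proof. by case: a => b c /=; rewrite sqr_sqrtr// addr_ge0 ?sqr_ge0. Qed.

Lemma Re_le_normc a : `|complex.Re a| <= normc a.
Proof.
rewrite -ler_sqr ?nnegrE ?normc_ge0// sqr_normcE real_normK ?num_real//.
by rewrite lerDl sqr_ge0.
Qed.

Lemma Im_le_normc a : `|complex.Im a| <= normc a.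
Proof.
rewrite -ler_sqr ?nnegrE ?normc_ge0// sqr_normcE real_normK ?num_real//.
by rewrite lerDr sqr_ge0.
Qed.


Lemma hnormZ a x : hnorm (a *: x) = normc a * hnorm x.
Proof.
apply/(@pexpIrn _ 2) => //; rewrite ?nnegrE ?mulr_ge0 ?normc_ge0 ?hnorm_ge0//.
apply: complexI; rewrite -inner_self innerZl innerZr mulrA mulc_conj inner_self.
by rewrite -rmorphM exprMn.
Qed.

Lemma hnorm_opp x : hnorm (- x) = hnorm x.
Proof. by rewrite -scaleN1r hnormZ normcN normc1 mul1r. Qed.

Lemma hnormBC x y : hnorm (x - y) = hnorm (y - x).
Proof. by rewrite -hnorm_opp opprB. Qed.

Lemma ReD a b : complex.Re (a + b) = complex.Re a + complex.Re b.
Proof. by case: a b => [? ?] [? ?]. Qed.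

Lemma ReN a : complex.Re (- a) = - complex.Re a.
Proof. by case: a. Qed.

Lemma ImD a b : complex.Im (a + b) = complex.Im a + complex.Im b.
Proof. by case: a b => [? ?] [? ?]. Qed.

Lemma ImN a : complex.Im (- a) = - complex.Im a.
Proof. by case: a. Qed.

Lemma Re_conjc a : complex.Re a^*%C = complex.Re a.
Proof. by case: a. Qed.

Lemma hnormBsqr x y :
  hnorm (x - y) ^+ 2 = hnorm x ^+ 2 - 2 * complex.Re (inner x y) + hnorm y ^+ 2.
Proof.
rewrite !sqr_hnorm innerBl !innerBr [inner y x]inner_conj.
rewrite !(ReD, ReN) Re_conjc; ring.
Qed.

Lemma hnormDsqr x y :
  hnorm (x + y) ^+ 2 = hnorm x ^+ 2 + 2 * complex.Re (inner x y) + hnorm y ^+ 2.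
Proof. by rewrite -{1}[y]opprK hnormBsqr innerNr ReN hnorm_opp; ring. Qed.

Lemma cauchy_schwarz x y : normc (inner x y) <= hnorm x * hnorm y.
Proof.
have [/hnorm_eq0 ->|y0] := eqVneq (hnorm y) 0.
  by rewrite inner0r normc0 hnorm0 mulr0.
have y2 : 0 < hnorm y ^+ 2 by rewrite exprn_gt0// lt_def y0 hnorm_ge0.
pose r := (hnorm y ^+ 2)^-1.
have r0 : 0 <= r by rewrite invr_ge0 ltW.
have E : (inner x y * r%:C)^*%C * inner x y = (normc (inner x y) ^+ 2 * r)%:C.
  by rewrite conjcM conjc_real mulrAC [_^*%C * inner x y]mulrC mulc_conj -rmorphM.
(* The subtracted vector is the projection of x onto the line spanned by y. *)
have := sqr_ge0 (hnorm (x - (inner x y * r%:C) *: y)).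
rewrite hnormBsqr innerZr hnormZ E normcM normc_real ger0_norm//= /r.
have -> : hnorm x ^+ 2 - 2 * (normc (inner x y) ^+ 2 / hnorm y ^+ 2) +
  (normc (inner x y) / hnorm y ^+ 2 * hnorm y) ^+ 2 =
  hnorm x ^+ 2 - normc (inner x y) ^+ 2 / hnorm y ^+ 2 by field.
rewrite subr_ge0 ler_pdivrMr// -exprMn.
by rewrite ler_sqr ?nnegrE ?mulr_ge0 ?normc_ge0 ?hnorm_ge0.
Qed.

Lemma le_hnormD x y : hnorm (x + y) <= hnorm x + hnorm y.
Proof.
rewrite -ler_sqr ?nnegrE ?addr_ge0 ?hnorm_ge0// hnormDsqr sqrrD.
rewrite lerD2r lerD2l -[X in _ <= X]mulr_natl ler_pM2l//.
apply: le_trans (cauchy_schwarz x y).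
exact: le_trans (ler_norm _) (Re_le_normc _).
Qed.

Lemma le_hnormB x y : hnorm (x - y) <= hnorm x + hnorm y.
Proof. by rewrite (le_trans (le_hnormD _ _))// hnorm_opp. Qed.

Lemma hnorm_triangle y x z : hnorm (x - z) <= hnorm (x - y) + hnorm (y - z).
Proof. by have := le_hnormD (x - y) (y - z); rewrite addrA subrK. Qed.

Lemma inner_ext x y : (forall z, inner x z = inner y z) -> x = y.
Proof.
move=> h; apply/eqP; rewrite -subr_eq0; apply/eqP/inner_eq0.
by rewrite innerBl h subrr.
Qed.

End PreHilbertTheory.

(** Limit arguments below end with a bound by a constant times e; absorbing the constant here spares
    tuning e each time. *)
Lemma le0_of_small (R : realType) (r : R) (C : R) :
  (forall e, 0 < e -> r <= C * e) -> r <= 0.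
Proof.
move=> h; apply/ler_addgt0Pl => e e0; rewrite addr0.
have C0 : 0 < `|C| + 1 by rewrite ltr_wpDl.
apply: le_trans (h (e / (`|C| + 1)) _) _; first by rewrite divr_gt0.
rewrite mulrA ler_pdivrMr// mulrC ler_pM2l//.
by rewrite (le_trans (ler_norm C))// lerDl.
Qed.

Section BoundedOperators.
Context {R : realType} {H : hilbertType R}.
Implicit Types (S T : H -> H) (x y : H) (C : R).

Definition op_bound T C := forall x, hnorm (T x) <= C * hnorm x.

Lemma linearfD T : linear T -> forall x y, T (x + y) = T x + T y.
Proof. by move=> l x y; have := l 1 x y; rewrite !scale1r. Qed.

Lemma linearf0 T : linear T -> T 0 = 0.
Proof.
by move=> l; apply: (addrI (T 0)); rewrite -(linearfD l) !addr0.
Qed.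

Lemma linearfZ T : linear T -> forall a x, T (a *: x) = a *: T x.
Proof. by move=> l a x; have := l a x 0; rewrite (linearf0 l) !addr0. Qed.

Lemma op_bound_bounded T C : linear T -> op_bound T C -> bounded_op T.
Proof. by move=> l h; split=> //; exists C. Qed.

Lemma bounded_op_bound T :
  bounded_op T -> exists2 C, 0 <= C & op_bound T C.
Proof.
move=> [_ [M hM]]; exists `|M| => // x.
by rewrite (le_trans (hM x))// ler_wpM2r ?hnorm_ge0// ler_norm.
Qed.

Lemma opnorm_le T C : 0 <= C -> op_bound T C -> opnorm T <= C.
Proof.
move=> C0 h; rewrite /opnorm; apply: ge_sup.
  by exists (hnorm (T 0)), 0 => //=; rewrite hnorm0.
move=> _ [x /= x1 <-]; rewrite (le_trans (h x))//.
by rewrite -[leRHS]mulr1 ler_wpM2l.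
Qed.

Lemma opnorm_bound T : bounded_op T -> op_bound T (opnorm T).
Proof.
move=> /[dup] -[l _] /bounded_op_bound[C C0 h] x.
have [/hnorm_eq0 ->|x0] := eqVneq (hnorm x) 0.
  by rewrite linearf0// hnorm0 mulr0.
have x_gt0 : 0 < hnorm x by rewrite lt_def x0 hnorm_ge0.
rewrite -ler_pdivrMr//.
have -> : hnorm (T x) / hnorm x = hnorm (T (((hnorm x)^-1)%:C *: x)).
  rewrite linearfZ// hnormZ normc_real ger0_norm ?invr_ge0 ?hnorm_ge0//.
  by rewrite mulrC.
apply: ub_le_sup.
  exists C => _ [y /= y1 <-]; rewrite (le_trans (h y))//.
  by rewrite -[leRHS]mulr1 ler_wpM2l.
exists (((hnorm x)^-1)%:C *: x) => //=.
by rewrite hnormZ normc_real ger0_norm ?invr_ge0 ?hnorm_ge0// mulVf.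
Qed.

Lemma bounded_op0 : bounded_op (0 : H -> H).
Proof.
have E z : (0 : H -> H) z = 0 by [].
split; first by move=> a x y; rewrite !E scaler0 addr0.
by exists 0 => x; rewrite mul0r E hnorm0.
Qed.

Lemma bounded_opD S T : bounded_op S -> bounded_op T -> bounded_op (S + T).
Proof.
move=> [lS [M hM]] [lT [N hN]]; split.
  by move=> a x y; rewrite !fctE lS lT scalerDr addrACA.
by exists (M + N) => x; rewrite fctE (le_trans (le_hnormD _ _))// mulrDl lerD.
Qed.

Lemma bounded_opZ (c : R[i]) T : bounded_op T -> bounded_op (c *: T).
Proof.
move=> [lT [M hM]]; split.
  move=> a x y; rewrite !fctE lT scalerDr; congr (_ + _).
  by rewrite !scalerA mulrC.
exists (normc c * M) => x; rewrite fctE hnormZ -mulrA.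
by rewrite ler_wpM2l ?normc_ge0.
Qed.

Lemma bounded_opN T : bounded_op T -> bounded_op (- T).
Proof. by rewrite -scaleN1r; exact: bounded_opZ. Qed.

Lemma bounded_opB S T : bounded_op S -> bounded_op T -> bounded_op (S - T).
Proof. by move=> hS hT; apply: bounded_opD => //; exact: bounded_opN. Qed.

Lemma bounded_op_comp S T : bounded_op S -> bounded_op T -> bounded_op (S \o T).
Proof.
move=> /[dup] -[lS _] /bounded_op_bound[M M0 hM] [lT [N hN]]; split.
  by move=> a x y; rewrite /= lT lS.
exists (M * N) => x; rewrite /= (le_trans (hM _))// -mulrA.
by rewrite ler_wpM2l.
Qed.

Lemma adjoint_sym T S : adjoint T S -> adjoint S T.
Proof. by move=> h x y; rewrite inner_conj -h -inner_conj. Qed.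

Lemma adjoint_unique T S S' : adjoint T S -> adjoint T S' -> S = S'.
Proof.
move=> /adjoint_sym h /adjoint_sym h'; apply/funext => x.
by apply: inner_ext => z; rewrite h h'.
Qed.

Lemma adjoint_linear T S : adjoint T S -> linear S.
Proof.
move=> /adjoint_sym h a x y; apply: inner_ext => z.
by rewrite innerDl innerZl !h innerDl innerZl.
Qed.

Lemma adjoint_bound T S C : adjoint T S -> op_bound T C -> op_bound S C.
Proof.
move=> h hT x; have [->|x0] := eqVneq (hnorm (S x)) 0.
  (* The sign of C is free, but a negative C forces x = 0. *)
  have := hT x; have [C0 _|C0] := leP 0 C; first by rewrite mulr_ge0 ?hnorm_ge0.
  have [/hnorm_eq0 ->|x0 hx] := eqVneq (hnorm x) 0; first by rewrite hnorm0 mulr0.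
  have := le_trans (hnorm_ge0 _) hx.
  by rewrite nmulr_rge0// => hx'; have /eqP := x0; case; apply/le_anti; rewrite hx' hnorm_ge0.
have Sx : 0 < hnorm (S x) by rewrite lt_def x0 hnorm_ge0.
rewrite -(ler_pM2l Sx) -expr2 sqr_hnorm -h.
apply: le_trans (ler_norm _) _; apply: le_trans (Re_le_normc _) _.
apply: le_trans (cauchy_schwarz _ _) _.
by rewrite mulrA ler_wpM2r ?hnorm_ge0// mulrC hT.
Qed.

Lemma adjoint_bounded T S : bounded_op T -> adjoint T S -> bounded_op S.
Proof.
move=> [_ [C hC]] h; apply: (@op_bound_bounded _ C).
  exact: adjoint_linear h.
exact: adjoint_bound h hC.
Qed.

(** Used twice: it makes the family intersected by [cstar_generated] nonempty, and it is the target
    algebra when the correspondence is applied to [Hq] itself. *)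
Lemma bounded_op_cstar : cstar_subalgebra (@bounded_op R H).
Proof.
split; split => //.
- exact: bounded_op0.
- exact: bounded_opD.
- exact: bounded_opZ.
- exact: bounded_op_comp.
- by move=> T S; exact: adjoint_bounded.
Qed.

(** Boundedness of X matters: otherwise the intersection would run over the empty family and contain
    every function. *)
Lemma cstar_generated_cstar (X : set (H -> H)) :
  X `<=` @bounded_op R H -> cstar_subalgebra (cstar_generated X).
Proof.
move=> Xb; split; split.
- by move=> T /(_ _ (conj bounded_op_cstar Xb)).
- by move=> A [[[]]].
- move=> S T hS hT A cA; have [[_ _ h _ _] _] := cA.1; apply: h; [exact: hS|exact: hT].
- move=> c T hT A cA; have [[_ _ _ h _] _] := cA.1; apply: h; exact: hT.
- move=> S T hS hT A cA; have [[_ _ _ _ h] _] := cA.1; apply: h; [exact: hS|exact: hT].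
- move=> T S hT hTS A cA; have [_ [h _]] := cA.1; apply: h hTS; exact: hT.
- move=> T bT hT A cA; have [_ [_ h]] := cA.1; apply: h => // e e0.
  by have [S hS hST] := hT e e0; exists S => //; exact: hS.
Qed.

End BoundedOperators.

(** * Matrices acting on vectors of a Hilbert space *)

(** The direct sum of copies of H indexed by I, that is C^I (x) H; the alias is there to carry its
    inner product. *)
Definition hfun (R : realType) (I : finType) (H : prehilbertType R) :=
  {ffun I -> H}.

Section FiniteSum.
Context {R : realType} {I : finType} {H : prehilbertType R}.
Implicit Types f g : hfun I H.

HB.instance Definition _ := GRing.Lmodule.on (hfun I H).

Definition hfun_inner f g : R[i] := \sum_i inner (f i) (g i).

Lemma hfun_inner_linearl g (a : R[i]) f h :
  hfun_inner (a *: f + h) g = a * hfun_inner f g + hfun_inner h g.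
Proof.
rewrite /hfun_inner mulr_sumr -big_split; apply: eq_bigr => i _ /=.
by rewrite !ffunE inner_linearl.
Qed.

Lemma hfun_inner_conj f g : hfun_inner g f = (hfun_inner f g)^*%C.
Proof.
rewrite /hfun_inner (rmorph_sum (@conjc R)).
by apply: eq_bigr => i _; exact: inner_conj.
Qed.

Lemma hfun_inner_ge0 f : 0 <= hfun_inner f f.
Proof. by apply: sumr_ge0 => i _; exact: inner_ge0. Qed.

Lemma hfun_inner_eq0 f : hfun_inner f f = 0 -> f = 0.
Proof.
move=> /eqP; rewrite psumr_eq0 => [|i _]; last exact: inner_ge0.
move=> /allP h; apply/ffunP => i; rewrite ffunE; apply/inner_eq0/eqP.
exact: h (mem_index_enum _).
Qed.

HB.instance Definition _ := isPreHilbert.Build R (hfun I H)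
  hfun_inner_linearl hfun_inner_conj hfun_inner_ge0 hfun_inner_eq0.

Lemma sqr_hnorm_hfun f : hnorm f ^+ 2 = \sum_i hnorm (f i) ^+ 2.
Proof.
apply: complexI; rewrite -inner_self (rmorph_sum (real_complex R)).
by apply: eq_bigr => i _; exact: inner_self.
Qed.

End FiniteSum.

Section MatrixAction.
Context {R : realType} {H : prehilbertType R}.

Definition vnormsq n (v : 'cV[R[i]]_n) : R := \sum_i normc (v i 0) ^+ 2.

(** For C >= 0 this says that the operator norm of M is at most C, in squared form and without
    introducing a matrix norm. *)
Definition mx_bound n (M : 'M[R[i]]_n) (C : R) :=
  forall v : 'cV_n, vnormsq (M *m v) <= C ^+ 2 * vnormsq v.

(* Gram-Schmidt without normalisation: a zero f k is harmless since x / 0 = 0. *)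
Lemma gram_schmidt n (h : 'I_n -> H) :
  exists (f : 'I_n -> H) (a : 'M[R[i]]_n),
    (forall k l, k != l -> inner (f k) (f l) = 0) /\
    forall j, h j = \sum_k a j k *: f k.
Proof.
elim: n h => [|n IH] h.
  by exists (fun=> 0), 0; split=> [k l|[]//]; rewrite inner0l.
have [f [a [fo hE]]] := IH (fun i => h (lift ord_max i)).
pose c k := inner (h ord_max) (f k) / inner (f k) (f k).
pose g := h ord_max - \sum_k c k *: f k.
have go k : inner g (f k) = 0.
  rewrite /g innerBl inner_suml (bigD1 k)//= big1 => [|l lk].
    rewrite addr0 innerZl /c; have [/inner_eq0 ->|fk] := eqVneq (inner (f k) (f k)) 0.
      by rewrite !inner0r mulr0 subrr.
    by rewrite divfK// subrr.
  by rewrite innerZl fo// mulr0.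
pose F (i : 'I_n.+1) := if unlift ord_max i is Some k then f k else g.
pose A : 'M[R[i]]_n.+1 := \matrix_(i, k)
  match unlift ord_max i, unlift ord_max k with
  | Some i', Some k' => a i' k'
  | Some _, None => 0
  | None, Some k' => c k'
  | None, None => 1
  end.
exists F, A; split.
  move=> k l; rewrite /F.
  case: unliftP => [k' ->|->]; case: unliftP => [l' ->|->] //.
  - by rewrite (inj_eq lift_inj) => /fo.
  - by rewrite inner_conj go conjc0.
  - by rewrite eqxx.
move=> j; rewrite (bigD1 ord_max)//= mxE /F unlift_none.
rewrite (reindex_omap (lift ord_max) (unlift ord_max))/=; last first.
  by move=> i iN; case: unliftP iN => [k -> //|->]; rewrite eqxx.
rewrite (eq_bigl predT); last by move=> k; rewrite liftK eqxx andbT eq_sym neq_lift.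
case: unliftP => [j' ->|->].
  rewrite scale0r add0r hE; apply: eq_bigr => k _.
  by rewrite mxE !liftK.
rewrite scale1r /g; under [X in _ = _ + X]eq_bigr do rewrite mxE unlift_none liftK.
by rewrite subrK.
Qed.

Lemma sqr_hnorm_orthogonal n (f : 'I_n -> H) (b : 'I_n -> R[i]) :
  (forall k l, k != l -> inner (f k) (f l) = 0) ->
  hnorm (\sum_k b k *: f k) ^+ 2 = \sum_k normc (b k) ^+ 2 * hnorm (f k) ^+ 2.
Proof.
move=> fo; apply: complexI; rewrite -inner_self inner_suml rmorph_sum /=.
apply: eq_bigr => k _; rewrite inner_sumr (bigD1 k)//= big1 ?addr0.
  by rewrite innerZl innerZr mulrA mulc_conj inner_self -rmorphM.
by move=> l lk; rewrite innerZl innerZr fo ?mulr0// eq_sym.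
Qed.

(** Tensoring M with the identity of H does not increase its norm. Expanding the vectors h j in an
    orthogonal family f, the coefficients along each f k form a column vector in C^n, to which the
    bound on M applies. *)
Lemma mx_bound_vectors n (M : 'M[R[i]]_n) C (h : 'I_n -> H) : mx_bound M C ->
  \sum_i hnorm (\sum_j M i j *: h j) ^+ 2 <= C ^+ 2 * \sum_i hnorm (h i) ^+ 2.
Proof.
move=> MC; have [f [a [fo hE]]] := gram_schmidt h.
have E i : \sum_j M i j *: h j = \sum_k (M *m a) i k *: f k.
  under eq_bigr do rewrite hE scaler_sumr.
  rewrite exchange_big; apply: eq_bigr => k _; rewrite mxE scaler_suml.
  by apply: eq_bigr => j _; rewrite scalerA.
under eq_bigr do rewrite E sqr_hnorm_orthogonal//.
under [X in _ <= _ * X]eq_bigr do rewrite hE sqr_hnorm_orthogonal//.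
rewrite exchange_big [X in _ <= _ * X]exchange_big mulr_sumr.
apply: ler_sum => k _; rewrite -mulr_suml -[X in _ <= _ * X]mulr_suml.
rewrite [X in _ <= X]mulrA ler_wpM2r ?sqr_ge0//.
have vE (b : 'M[R[i]]_n) :
    vnormsq (col k b) = \sum_i normc (b i k) ^+ 2.
  by apply: eq_bigr => i _; rewrite mxE.
by rewrite -!vE [X in vnormsq X]colE -mulmxA -colE.
Qed.

End MatrixAction.

(** * The discrete Parseval identity *)

Section Expi.
Context {R : realType}.
Implicit Types s t : R.

Lemma expi0 : expi 0 = 1 :> R[i].
Proof. by rewrite /expi cos0 sin0. Qed.

Lemma expiD s t : expi (s + t) = expi s * expi t.
Proof.
rewrite /expi cosD sinD; apply/eqP; rewrite eq_complex /=.
by apply/andP; split; apply/eqP => //; ring.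
Qed.

Lemma expiMn t n : expi (t *+ n) = expi t ^+ n.
Proof.
by elim: n => [|n IH]; rewrite ?mulr0n ?expi0// mulrS expiD IH exprS.
Qed.

Lemma normc_expi t : normc (expi t) = 1.
Proof. by rewrite /expi /= cos2Dsin2 sqrtr1. Qed.

Lemma expi_conjM t : expi t * (expi t)^*%C = 1.
Proof. by rewrite mulc_conj normc_expi expr1n. Qed.

Lemma expi_neq0 t : expi t != 0.
Proof. by apply/eqP => /(congr1 (@normc R)) /eqP; rewrite normc_expi normc0 oner_eq0. Qed.

Lemma expi_2pi : expi (2 * pi) = 1 :> R[i].
Proof. by rewrite /expi mulr_natl cos2pi sin2pi. Qed.

Lemma expi_neq1 t : 0 < t < 2 * pi -> expi t != 1.
Proof.
move=> /andP[t0 t2]; apply/eqP => -[+ _] => /eqP; apply/negP.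
(* By cos t = 1 - 2 sin(t/2)^2, where t/2 lies strictly between 0 and pi. *)
rewrite (_ : t = t / 2 + t / 2); last by field.
rewrite cosD -!expr2 cos2sin2 lt_eqF//.
have : 0 < sin (t / 2) ^+ 2.
  by rewrite exprn_gt0// sin_gt0_pi// divr_gt0//= ltr_pdivrMr// mulrC.
by move=> h; lra.
Qed.

Lemma expi_primitive n : n.+1.-primitive_root (expi (2 * pi / n.+1%:R) : R[i]).
Proof.
apply/andP; split=> //; apply/forallP => i; apply/eqP; rewrite unity_rootE -expiMn.
have [->|i1] := eqVneq i.+1 n.+1.
  by rewrite -[_ *+ _]mulr_natr divfK ?pnatr_eq0// expi_2pi eqxx.
apply/negbTE/expi_neq1; rewrite -[_ *+ _]mulr_natr.
have pi2 : 0 < 2 * pi :> R by rewrite mulr_gt0 ?pi_gt0.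
rewrite mulr_gt0 ?divr_gt0//= mulrAC ltr_pdivrMr// ltr_pM2l// ltr_nat.
by rewrite ltn_neqAle i1 ltn_ord.
Qed.

End Expi.

Section Parseval.
Context {R : realType} {H : prehilbertType R} (n : nat).
Let z : R[i] := expi (2 * pi / n.+1%:R).

Lemma root_orthogonality (k l : 'I_n.+1) :
  \sum_(j < n.+1) z ^+ (j * k) * (z ^+ (j * l))^*%C = ((k == l) * n.+1)%:R.
Proof.
have zc m : (z ^+ m)^*%C = (z ^+ m)^-1.
  apply: (@mulfI _ (z ^+ m)); first by rewrite expf_neq0// expi_neq0.
  by rewrite divff ?expf_neq0 ?expi_neq0// -expiMn expi_conjM.
(* The sum is geometric with ratio w, a root of unity of order dividing n + 1 that is 1 only for k =
   l. *)
pose w := z ^+ k / z ^+ l.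
have -> : \sum_(j < n.+1) z ^+ (j * k) * (z ^+ (j * l))^*%C = \sum_(j < n.+1) w ^+ j.
  by apply: eq_bigr => j _; rewrite zc /w exprMn exprVn -!exprM ![(j * _)%N]mulnC.
have pz : n.+1.-primitive_root z := expi_primitive n.
have [kl|kl] := eqVneq k l.
  rewrite /w kl divff ?expf_neq0 ?expi_neq0// mul1n.
  by under eq_bigr do rewrite expr1n; rewrite sumr_const card_ord.
have w1 : w - 1 != 0.
  rewrite subr_eq0; apply/eqP => h.
  have /eqP : z ^+ k = z ^+ l.
    by rewrite -[LHS](divfK (_ : z ^+ l != 0)) -/w ?h ?mul1r// expf_neq0 ?expi_neq0.
  by rewrite (eq_prim_root_expr pz) !modn_small// => /eqP/val_inj/eqP; exact/negP.
apply: (mulfI w1); rewrite -subrX1 mulr0 /w exprMn exprVn -!exprM.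
by rewrite ![(_ * n.+1)%N]mulnC !exprM (prim_expr_order pz) !expr1n divr1 subrr.
Qed.

Lemma parseval (g h : 'I_n.+1 -> H) :
  \sum_(j < n.+1) inner (\sum_(k < n.+1) z ^+ (j * k) *: g k) (\sum_(k < n.+1) z ^+ (j * k) *: h k)
  = n.+1%:R * \sum_k inner (g k) (h k).
Proof.
have -> : \sum_(j < n.+1) inner (\sum_(k < n.+1) z ^+ (j * k) *: g k) (\sum_(k < n.+1) z ^+ (j * k) *: h k)
    = \sum_(k < n.+1) \sum_(l < n.+1) (\sum_(j < n.+1) z ^+ (j * k) * (z ^+ (j * l))^*%C) * inner (g k) (h l).
  under [RHS]eq_bigr do under eq_bigr do rewrite mulr_suml.
  under [RHS]eq_bigr do rewrite exchange_big.
  rewrite [RHS]exchange_big; apply: eq_bigr => j _.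
  rewrite inner_suml; apply: eq_bigr => k _.
  rewrite inner_sumr; apply: eq_bigr => l _.
  by rewrite innerZl innerZr mulrA.
rewrite mulr_sumr; apply: eq_bigr => k _.
rewrite (bigD1 k)//= root_orthogonality eqxx mul1n big1 ?addr0// => l lk.
by rewrite root_orthogonality eq_sym (negbTE lk) mul0r.
Qed.

End Parseval.

(** * Trigonometric polynomials on the grid and their shifts *)

Section Synthesis.
Context {R : realType} {H : prehilbertType R} {q : nat} (n : nat).
Local Notation z := (expi (2 * pi / n.+1%:R) : R[i]).
Local Notation scale := ((n.+1%:R^-1 ^+ 2)%:C : R[i]).
Definition grid : finType := ('I_n.+1 * 'I_n.+1 * 'I_q)%type.
Implicit Types (Phi Psi : nat -> nat -> 'I_q -> H).

(* The trigonometric polynomial with coefficients Phi, sampled on a grid of the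
   torus; the scale makes [embed] below an isometry. *)
Definition synth Phi : hfun grid H :=
  [ffun x : grid => scale *: \sum_(k1 < n.+1) \sum_(k2 < n.+1)
     (z ^+ (x.1.1 * k1) * z ^+ (x.1.2 * k2)) *: Phi k1 k2 x.2].

(** Parseval in each of the two torus directions contributes a factor n + 1, and the scale (n +
    1)^-2 enters twice. The product is the scale again, so the right side is an average over the box
    of indices. *)
Lemma inner_synth Phi Psi : inner (synth Phi) (synth Psi) =
  scale * \sum_(k1 < n.+1) \sum_(k2 < n.+1) \sum_i inner (Phi k1 k2 i) (Psi k1 k2 i).
Proof.
have E Th (j1 j2 : 'I_n.+1) i : synth Th (j1, j2, i) = scale *:
    \sum_(k1 < n.+1) z ^+ (j1 * k1) *: \sum_(k2 < n.+1) z ^+ (j2 * k2) *: Th k1 k2 i.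
  rewrite ffunE; congr (_ *: _); apply: eq_bigr => k1 _; rewrite scaler_sumr.
  by apply: eq_bigr => k2 _; rewrite scalerA.
transitivity (\sum_(j1 < n.+1) \sum_(j2 < n.+1) \sum_i
    inner (synth Phi (j1, j2, i)) (synth Psi (j1, j2, i))).
  by rewrite !pair_bigA; apply: eq_bigr => -[[? ?] ?] _.
rewrite exchange_big /=.
under eq_bigr do rewrite exchange_big /=.
rewrite exchange_big /=.
have -> : \sum_(k1 < n.+1) \sum_(k2 < n.+1) \sum_i inner (Phi k1 k2 i) (Psi k1 k2 i) =
   \sum_i \sum_(k1 < n.+1) \sum_(k2 < n.+1) inner (Phi k1 k2 i) (Psi k1 k2 i).
  by under eq_bigr do rewrite exchange_big; rewrite exchange_big.
rewrite mulr_sumr; apply: eq_bigr => i _.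
under eq_bigr do under eq_bigr do rewrite !E innerZl innerZr.
under eq_bigr => j2 _.
  rewrite -!mulr_sumr.
  rewrite (parseval (fun k1 => \sum_(k2 < n.+1) z ^+ (j2 * k2) *: Phi k1 k2 i)
    (fun k1 => \sum_(k2 < n.+1) z ^+ (j2 * k2) *: Psi k1 k2 i)) mulr_sumr.
  over.
rewrite -!mulr_sumr conjc_real exchange_big /=.
under eq_bigr => k1 _ do
  rewrite -mulr_sumr (parseval (fun k2 => Phi k1 k2 i) (fun k2 => Psi k1 k2 i)).
rewrite -!mulr_sumr !mulrA; congr (_ * _).
rewrite -(rmorph_nat (real_complex R)) -!rmorphM /=.
by congr (_%:C); field.
Qed.

Lemma sqr_hnorm_synth Phi : hnorm (synth Phi) ^+ 2 =
  n.+1%:R^-1 ^+ 2 * \sum_(k1 < n.+1) \sum_(k2 < n.+1) \sum_i hnorm (Phi k1 k2 i) ^+ 2.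
Proof.
apply: complexI; rewrite -inner_self inner_synth [RHS]rmorphM; congr (_ * _).
rewrite rmorph_sum; apply: eq_bigr => k1 _; rewrite rmorph_sum.
apply: eq_bigr => k2 _; rewrite rmorph_sum; apply: eq_bigr => i _.
exact: inner_self.
Qed.

Lemma expz_period j : z ^+ (j * n.+1) = 1.
Proof. by rewrite mulnC exprM (prim_expr_order (expi_primitive n)) expr1n. Qed.

(** The squared norm is an average over (n + 1)^2 indices; coefficients supported on at most n + 1
    of them, such as an edge of the box, make it O(1/n). *)
Let boundary_bound Psi C (r : nat -> nat -> bool) :
  (\sum_(k1 < n.+1) \sum_(k2 < n.+1) r k1 k2 <= n.+1)%N ->
  (forall k1 k2 i, hnorm (Psi k1 k2 i) ^+ 2 <= (r k1 k2)%:R * C) ->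
  0 <= C -> hnorm (synth Psi) ^+ 2 <= q%:R * C / n.+1%:R.
Proof.
move=> r1 hP C0; rewrite sqr_hnorm_synth.
have -> : q%:R * C / n.+1%:R = n.+1%:R^-1 ^+ 2 * (n.+1%:R * (q%:R * C)) by field.
rewrite ler_wpM2l ?sqr_ge0//.
apply: le_trans (_ : \sum_(k1 < n.+1) \sum_(k2 < n.+1) (r k1 k2)%:R * (q%:R * C) <= _).
  apply: ler_sum => k1 _; apply: ler_sum => k2 _.
  apply: le_trans (_ : \sum_(i < q) (r k1 k2)%:R * C <= _).
    by apply: ler_sum => i _; exact: hP.
  by rewrite sumr_const card_ord -[leLHS]mulr_natl mulrCA.
under eq_bigr do rewrite -mulr_suml -natr_sum.
by rewrite -mulr_suml -natr_sum ler_wpM2r ?mulr_ge0 ?ler_nat.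
Qed.

Lemma sum_shift (V : zmodType) (f : nat -> V) m :
  \sum_(k < m) f k.+1 - \sum_(k < m) f k = f m - f 0%N.
Proof.
by rewrite -sumrB -(big_mkord xpredT (fun k => f k.+1 - f k)) telescope_sumr.
Qed.

Let sqr_hnorm_sub (x y : H) C : hnorm x <= C -> hnorm y <= C ->
  hnorm (x - y) ^+ 2 <= 4 * C ^+ 2.
Proof.
move=> hx hy; have C0 := le_trans (hnorm_ge0 x) hx.
rewrite (_ : 4 * C ^+ 2 = (C + C) ^+ 2); last by ring.
rewrite ler_sqr ?nnegrE ?hnorm_ge0 ?addr_ge0//.
by rewrite (le_trans (le_hnormB _ _))// lerD.
Qed.

(* Multiplication by a coordinate of the torus shifts coefficients, so that the
   difference telescopes to boundary terms. *)
Lemma synth_shift1 Phi C (G := [ffun x : grid => z ^+ x.1.1 *: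
    synth (fun k1 k2 i => Phi k1.+1 k2 i) x] : hfun grid H) :
  (forall k1 k2 i, hnorm (Phi k1 k2 i) <= C) ->
  hnorm (G - synth Phi) ^+ 2 <= q%:R * (4 * C ^+ 2) / n.+1%:R.
Proof.
(* The edge k1 = n + 1 wraps around to frequency 0 because z^(n + 1) = 1, so both boundary terms sit
   on the edge k1 = 0. *)
move=> hC; pose Psi (k1 k2 : nat) i :=
  (k1 == 0%N)%:R *: (Phi n.+1 k2 i - Phi 0%N k2 i) : H.
have -> : G - synth Phi = synth Psi.
  apply/ffunP => -[[j1 j2] i]; rewrite !ffunE /= scalerA mulrC -scalerA.
  rewrite -scalerBr; congr (_ *: _).
  pose f k := \sum_(k2 < n.+1) (z ^+ (j1 * k) * z ^+ (j2 * k2)) *: Phi k k2 i.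
  have -> : z ^+ j1 *: (\sum_(k1 < n.+1) \sum_(k2 < n.+1)
      (z ^+ (j1 * k1) * z ^+ (j2 * k2)) *: Phi k1.+1 k2 i) = \sum_(k1 < n.+1) f k1.+1.
    rewrite scaler_sumr; apply: eq_bigr => k1 _; rewrite scaler_sumr.
    by apply: eq_bigr => k2 _; rewrite scalerA mulrA -exprD mulnS.
  rewrite [LHS](sum_shift f) big_ord_recl [X in _ = _ + X]big1; last first.
    by move=> k1 _; rewrite big1// => k2 _; rewrite /Psi scale0r scaler0.
  rewrite addr0 -sumrB; apply: eq_bigr => k2 _.
  by rewrite expz_period /Psi muln0 expr0 eqxx scale1r scalerBr.
apply: (@boundary_bound _ _ (fun k _ => k == 0%N)) => [|k1 k2 i|].
- rewrite big_ord_recl [X in (_ + X)%N]big1 => [|k1 _]; last by rewrite big1.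
  by rewrite addn0 sum_nat_const card_ord muln1.
- rewrite /Psi; case: eqP => _; first by rewrite scale1r mul1r sqr_hnorm_sub.
  by rewrite scale0r hnorm0 expr0n mul0r.
- by rewrite mulr_ge0 ?sqr_ge0.
Qed.

Lemma synth_shift2 Phi C (G := [ffun x : grid => z ^+ x.1.2 *:
    synth (fun k1 k2 i => Phi k1 k2.+1 i) x] : hfun grid H) :
  (forall k1 k2 i, hnorm (Phi k1 k2 i) <= C) ->
  hnorm (G - synth Phi) ^+ 2 <= q%:R * (4 * C ^+ 2) / n.+1%:R.
Proof.
move=> hC; pose Psi (k1 k2 : nat) i :=
  (k2 == 0%N)%:R *: (Phi k1 n.+1 i - Phi k1 0%N i) : H.
have -> : G - synth Phi = synth Psi.
  apply/ffunP => -[[j1 j2] i]; rewrite !ffunE /= scalerA mulrC -scalerA.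
  rewrite -scalerBr; congr (_ *: _); rewrite scaler_sumr -sumrB.
  apply: eq_bigr => k1 _.
  pose f k := (z ^+ (j1 * k1) * z ^+ (j2 * k)) *: Phi k1 k i.
  have -> : z ^+ j2 *: (\sum_(k2 < n.+1)
      (z ^+ (j1 * k1) * z ^+ (j2 * k2)) *: Phi k1 k2.+1 i) = \sum_(k2 < n.+1) f k2.+1.
    rewrite scaler_sumr; apply: eq_bigr => k2 _.
    by rewrite /f scalerA mulrCA -(exprD _ j2) -mulnS.
  rewrite [LHS](sum_shift f) big_ord_recl [X in _ = _ + X]big1; last first.
    by move=> k2 _; rewrite /Psi scale0r scaler0.
  by rewrite addr0 /f expz_period /Psi muln0 expr0 eqxx scale1r scalerBr.
apply: (@boundary_bound _ _ (fun _ k => k == 0%N)) => [|k1 k2 i|].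
- rewrite (eq_bigr (fun=> 1%N)) => [|k1 _].
    by rewrite sum_nat_const card_ord muln1.
  by rewrite big_ord_recl big1.
- rewrite /Psi; case: eqP => _; first by rewrite scale1r mul1r sqr_hnorm_sub.
  by rewrite scale0r hnorm0 expr0n mul0r.
- by rewrite mulr_ge0 ?sqr_ge0.
Qed.

End Synthesis.

(** * Asymptotic intertwiners *)

Section GridAction.
Context {R : realType} {H : hilbertType R} {q n : nat}.
Local Notation grid := (@grid q n).
Implicit Types (a b : R * R -> 'M[R[i]]_q) (G : hfun grid H).

(** Symbols have period q in each variable. With steps of q / (n + 1), the phase 2 pi x / q at the
    j-th point is 2 pi j / (n + 1), the argument of z^j. *)
Definition gridpt (x : grid) : R * R :=
  (q%:R * x.1.1%:R / n.+1%:R, q%:R * x.1.2%:R / n.+1%:R).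

Definition mxadj (M : 'M[R[i]]_q) : 'M[R[i]]_q := map_mx conjc M^T.

Definition act a G : hfun grid H :=
  [ffun x : grid => \sum_j a (gridpt x) x.2 j *: G (x.1, j)].

Lemma act_linear a (c : R[i]) G G' : act a (c *: G + G') = c *: act a G + act a G'.
Proof.
apply/ffunP => x; rewrite !ffunE scaler_sumr -big_split; apply: eq_bigr => j _ /=.
by rewrite !ffunE scalerDr !scalerA mulrC.
Qed.

Lemma actB a G G' : act a (G - G') = act a G - act a G'.
Proof. by rewrite addrC -scaleN1r act_linear scaleN1r addrC. Qed.

Lemma act_lin2 (c : R[i]) a b G :
  act (fun x => c *: a x + b x) G = c *: act a G + act b G.
Proof.
apply/ffunP => x; rewrite !ffunE scaler_sumr -big_split; apply: eq_bigr => j _ /=.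
by rewrite !mxE scalerDl scalerA.
Qed.

Lemma actM a b G : act (fun x => a x *m b x) G = act a (act b G).
Proof.
apply/ffunP => x; rewrite !ffunE.
under eq_bigr do rewrite mxE scaler_suml.
rewrite exchange_big; apply: eq_bigr => j _ /=.
by rewrite ffunE scaler_sumr; apply: eq_bigr => k _; rewrite scalerA.
Qed.

Lemma act1 G : act (fun=> 1%:M) G = G.
Proof.
apply/ffunP => -[x i]; rewrite ffunE (bigD1 i)//= big1 => [|j ji].
  by rewrite mxE eqxx scale1r addr0.
by rewrite mxE eq_sym (negbTE ji) scale0r.
Qed.

Lemma sum_grid (V : nmodType) (F : grid -> V) :
  \sum_x F x = \sum_(y : 'I_n.+1 * 'I_n.+1) \sum_j F (y, j).
Proof. by rewrite pair_bigA; apply: eq_bigr => -[]. Qed.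

Lemma act_adj a G G' : inner (act a G) G' = inner G (act (mxadj \o a) G').
Proof.
rewrite /inner /= /hfun_inner.
rewrite !sum_grid.
apply: eq_bigr => x _; under eq_bigr do rewrite ffunE inner_suml.
rewrite exchange_big; apply: eq_bigr => j _ /=.
rewrite ffunE inner_sumr; apply: eq_bigr => i _ /=.
by rewrite innerZl innerZr !mxE conjcK.
Qed.

Lemma act_bound a C G : 0 <= C -> (forall x, mx_bound (a x) C) ->
  hnorm (act a G) <= C * hnorm G.
Proof.
move=> C0 aC; rewrite -ler_sqr ?nnegrE ?mulr_ge0 ?hnorm_ge0// exprMn.
rewrite !sqr_hnorm_hfun.
rewrite !sum_grid mulr_sumr; apply: ler_sum => x _.
under eq_bigr do rewrite ffunE.
exact: (mx_bound_vectors (fun j => G (x, j))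
  (aC (q%:R * x.1%:R / n.+1%:R, q%:R * x.2%:R / n.+1%:R))).
Qed.

End GridAction.

Section ApproximateIntertwiner.
Context {R : realType} {H : hilbertType R} {q : nat}.
Variables (U V Ui Vi : H -> H) (w : R[i]).
Hypotheses (q_gt0 : (0 < q)%N) (wq : w ^+ q = 1).
Hypotheses (linUi : linear Ui) (linVi : linear Vi).
Hypotheses (UiK : cancel Ui U) (UK : cancel U Ui) (VK : cancel V Vi).
Hypotheses (Ui_iso : forall x y, inner (Ui x) (Ui y) = inner x y).
Hypotheses (Vi_iso : forall x y, inner (Vi x) (Vi y) = inner x y).
Hypotheses (V_iso : forall x y, inner (V x) (V y) = inner x y).
Hypotheses (U_iso : forall x y, inner (U x) (U y) = inner x y).
Hypotheses (UV : forall x, U (V x) = w *: V (U x)).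
Implicit Types (a b : R * R -> 'M[R[i]]_q) (S T : H -> H).

(* Component along e_i of U0^k1 V0^k2 e_0 (x) V^-k2 U^-k1 xi: the vector
   U0^k1 V0^k2 e_0 is e_(-k1 mod q). *)
Definition orbit_coef (xi : H) (k1 k2 : nat) (i : 'I_q) : H :=
  (q %| k1 + i)%N%:R *: iter k2 Vi (iter k1 Ui xi).

Definition embed n (xi : H) : hfun (@grid q n) H := synth n (orbit_coef xi).

Lemma iter_linear (F : H -> H) k : linear F -> linear (iter k F).
Proof. by move=> lF; elim: k => [//|k IH] a x y; rewrite iterS IH lF. Qed.

Lemma iter_iso (F : H -> H) k : (forall x y, inner (F x) (F y) = inner x y) ->
  forall x y, inner (iter k F x) (iter k F y) = inner x y.
Proof. by move=> iF x y; elim: k => //= k IH; rewrite iF. Qed.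

Lemma hnorm_iso (F : H -> H) : (forall x y, inner (F x) (F y) = inner x y) ->
  forall x, hnorm (F x) = hnorm x.
Proof. by move=> iF x; rewrite /hnorm iF. Qed.

Lemma synth_lin n (c : R[i]) (Phi Psi : nat -> nat -> 'I_q -> H) :
  synth n (fun k1 k2 i => c *: Phi k1 k2 i + Psi k1 k2 i) =
  c *: synth n Phi + synth n Psi.
Proof.
apply/ffunP => x; rewrite !ffunE [c *: _]scalerA [c * _]mulrC -scalerA -scalerDr.
congr (_ *: _); rewrite scaler_sumr -big_split; apply: eq_bigr => k1 _ /=.
rewrite scaler_sumr -big_split; apply: eq_bigr => k2 _ /=.
by rewrite scalerDr !scalerA; congr (_ *: _ + _); rewrite mulrC.
Qed.

Lemma embed_linear n (c : R[i]) x y : embed n (c *: x + y) = c *: embed n x + embed n y.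
Proof.
rewrite /embed -synth_lin; congr synth.
apply/funext => k1; apply/funext => k2; apply/funext => i.
rewrite /orbit_coef !iter_linear// scalerDr !scalerA; congr (_ *: _ + _).
by rewrite mulrC.
Qed.

Lemma embedB n x y : embed n (x - y) = embed n x - embed n y.
Proof. by rewrite addrC -scaleN1r embed_linear scaleN1r addrC. Qed.

Lemma residue_sum k : \sum_(i < q) (q %| k + i)%N%:R = 1 :> R[i].
Proof.
(* The outer modulus matters only when q divides k: then q - k mod q is q itself, out of range. *)
pose i0 : 'I_q := Ordinal (ltn_pmod (q - k %% q) q_gt0).
rewrite (bigD1 i0)//= big1 => [|i ii0]; last first.
  rewrite (_ : (_ %| _)%N = false)//; apply: contraNF ii0 => qki; apply/eqP/val_inj => /=.
  rewrite -(modn_small (ltn_ord i)); apply/eqP.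
  rewrite -(eqn_modDl (k %% q)) subnKC ?(ltnW (ltn_pmod _ _))// modnn modnDml.
  by move: qki; rewrite /dvdn.
rewrite addr0 (_ : (_ %| _)%N)// /dvdn -modnDml modnDmr.
by rewrite subnKC ?(ltnW (ltn_pmod _ _))// modnn.
Qed.

(** For each (k1, k2) exactly one component of the coefficient is nonzero, and it is an isometric
    image of the vector; hence every term of the average in [inner_synth] equals inner x y. *)
Lemma inner_embed n x y : inner (embed n x) (embed n y) = inner x y.
Proof.
rewrite inner_synth.
have E k1 k2 : \sum_i inner (orbit_coef x k1 k2 i) (orbit_coef y k1 k2 i) = inner x y.
  rewrite -[RHS]mul1r -(residue_sum k1) mulr_suml; apply: eq_bigr => i _.
  rewrite /orbit_coef innerZl innerZr !iter_iso//.
  by case: (q %| k1 + i)%N; rewrite ?mul0r// conjc1 !mul1r.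
under eq_bigr do under eq_bigr do rewrite E.
rewrite !sumr_const card_ord -mulrnA -[inner x y *+ _]mulr_natl mulrA.
rewrite -(rmorph_nat (real_complex R)) -rmorphM natrM.
rewrite (_ : n.+1%:R^-1 ^+ 2 * (n.+1%:R * n.+1%:R) = 1 :> R) ?mul1r//.
by field.
Qed.

Lemma hnorm_embed n x : hnorm (embed n x) = hnorm x.
Proof. by rewrite /hnorm inner_embed. Qed.

(* The intertwining is only asymptotic: it holds up to errors that vanish as the
   grid gets finer. *)
Definition intertwines a T := forall xi,
  (fun n => hnorm (act a (embed n xi) - embed n (T xi))) @ \oo --> (0 : R).

Lemma squeeze0 (u v : nat -> R) : (forall n, 0 <= u n <= v n) ->
  v @ \oo --> (0 : R) -> u @ \oo --> (0 : R).
Proof.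
move=> uv v0; apply: (squeeze_cvgr _ (cvg_cst 0) v0).
by near=> n; exact: uv.
Unshelve. all: by end_near. Qed.

Lemma intertwines_lin (c : R[i]) a b S T : intertwines a S -> intertwines b T ->
  intertwines (fun x => c *: a x + b x) (c *: S + T).
Proof.
move=> aS bT xi.
apply: (@squeeze0 _ (fun n => normc c * hnorm (act a (embed n xi) - embed n (S xi))
   + hnorm (act b (embed n xi) - embed n (T xi)))) => [n|].
  rewrite hnorm_ge0/= act_lin2 !fctE embed_linear opprD addrACA -scalerBr.
  by rewrite (le_trans (le_hnormD _ _))// hnormZ.
rewrite -[X in _ --> X]addr0 -[X in _ --> X + _](mulr0 (normc c)).
by apply: cvgD; [apply: cvgMr; exact: aS|exact: bT].
Qed.

(** With J for [embed n], a b J - J S T = a (b J - J T) + (a J - J S) T; the uniform bound on a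
    controls the first term. *)
Lemma intertwinesM a b S T C : 0 <= C -> (forall x, mx_bound (a x) C) ->
  intertwines a S -> intertwines b T -> intertwines (fun x => a x *m b x) (S \o T).
Proof.
move=> C0 aC aS bT xi.
apply: (@squeeze0 _ (fun n => C * hnorm (act b (embed n xi) - embed n (T xi))
   + hnorm (act a (embed n (T xi)) - embed n (S (T xi))))) => [n|].
  rewrite hnorm_ge0/= actM.
  apply: le_trans (hnorm_triangle (act a (embed n (T xi))) _ _) _.
  by rewrite lerD2r -actB act_bound.
rewrite -[X in _ --> X]addr0 -[X in _ --> X + _](mulr0 C).
by apply: cvgD; [apply: cvgMr; exact: bT|exact: aS].
Qed.

(** With J for [embed n], |T xi| = |J T xi| <= |a J xi| + o(1) <= C |xi| + o(1). *)
Lemma intertwines_bound a T C : 0 <= C -> (forall x, mx_bound (a x) C) ->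
  intertwines a T -> op_bound T C.
Proof.
move=> C0 aC aT xi; rewrite -subr_le0.
apply: (@cvgr_to_ge _ _ _ _ _ _ _ (aT xi)).
near=> n; rewrite -(hnorm_embed n (T xi)) -(hnorm_embed n xi) lerBlDr.
apply: le_trans (_ : hnorm (act a (embed n xi)) + hnorm (act a (embed n xi) - embed n (T xi)) <= _).
  by rewrite -{1}[embed n (T xi)](subKr (act a (embed n xi))) le_hnormB.
by rewrite addrC lerD2l act_bound.
Unshelve. all: by end_near. Qed.

(** The isometries carry both inner products to the grid, where a and its adjoint symbol are exactly
    adjoint. The two intertwining errors enter through Cauchy-Schwarz and vanish in the limit. *)
Lemma intertwines_adjoint a S T : intertwines a T -> intertwines (@mxadj R q \o a) S -> adjoint T S.
Proof.
move=> aT aS x y; apply/eqP; rewrite -subr_eq0; apply/eqP/eq0_normc/le_anti.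
rewrite normc_ge0 andbT.
have h : (fun n => hnorm y * hnorm (act a (embed n x) - embed n (T x)) +
    hnorm x * hnorm (act (@mxadj R q \o a) (embed n y) - embed n (S y)))
    @ \oo --> (0 : R).
  rewrite -[X in _ --> X]addr0 -[X in _ --> X + _](mulr0 (hnorm y)).
  rewrite -[X in _ --> _ + X](mulr0 (hnorm x)).
  by apply: cvgD; apply: cvgMr; [exact: aT|exact: aS].
apply: (@cvgr_to_ge _ _ _ _ _ _ _ h).
near=> n; rewrite -(inner_embed n (T x)) -(inner_embed n x (S y)).
set X := embed n x; set Y := embed n y.
have -> : inner (embed n (T x)) Y - inner X (embed n (S y)) =
    inner X (act (@mxadj R q \o a) Y - embed n (S y)) -
    inner (act a X - embed n (T x)) Y.
  by rewrite innerBr innerBl -act_adj; ring.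
rewrite -(hnorm_embed n x) -(hnorm_embed n y) -/X -/Y addrC.
apply: le_trans (le_normcD _ _) _; rewrite normcN.
by rewrite lerD// mulrC (le_trans (cauchy_schwarz _ _))// mulrC.
Unshelve. all: by end_near. Qed.

Lemma intertwines_limit a T :
  (forall e, 0 < e -> exists b S, [/\ intertwines b S,
     forall x, mx_bound (a x - b x) e & op_bound (T - S) e]) -> intertwines a T.
Proof.
move=> h xi; apply/cvgr0Pnorm_le => e e0.
(* The three errors are d |xi| for the symbol, d for b and S, and d |xi| for the operator; they add
   up to e. *)
pose d := e / (2 * hnorm xi + 1).
have d0 : 0 < d by rewrite divr_gt0// ltr_wpDl// mulr_ge0 ?hnorm_ge0.
have [b [S [bS ab TS]]] := h d d0.
have /cvgr0Pnorm_le/(_ d d0) := bS xi; apply: filterS => n.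
rewrite !ger0_norm ?hnorm_ge0// => hn.
have E1 : hnorm (act a (embed n xi) - act b (embed n xi)) <= d * hnorm xi.
  rewrite -(hnorm_embed n xi); have := act_bound (embed n xi) (ltW d0) ab.
  suff -> : act (fun x => a x - b x) (embed n xi) =
    act a (embed n xi) - act b (embed n xi) by [].
  rewrite -[in RHS]scaleN1r addrC -act_lin2; congr act.
  by apply/funext => x; rewrite scaleN1r addrC.
have E2 : hnorm (embed n (S xi) - embed n (T xi)) <= d * hnorm xi.
  by rewrite -embedB hnorm_embed hnormBC; exact: TS.
apply: le_trans (hnorm_triangle (act b (embed n xi)) _ _) _.
apply: le_trans (lerD E1 (le_trans (hnorm_triangle (embed n (S xi)) _ _) (lerD hn E2))) _.
rewrite le_eqVlt; apply/orP; left; apply/eqP; rewrite /d; field.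
by rewrite gt_eqF// ltr_wpDl// mulr_ge0 ?hnorm_ge0.
Qed.

(** With J for [embed n] and b for the adjoint symbol, b a = 1 gives b J - J T^-1 = - b (a J - J T)
    T^-1. This is how adjoints of the generators get their intertwining. *)
Lemma intertwines_inverse a T Ti C : 0 <= C -> (forall x, mx_bound (mxadj (a x)) C) ->
  (forall x, mxadj (a x) *m a x = 1%:M) -> cancel Ti T ->
  intertwines a T -> intertwines (@mxadj R q \o a) Ti.
Proof.
move=> C0 aC aa TiK aT xi.
apply: (@squeeze0 _ (fun n => C * hnorm (act a (embed n (Ti xi)) - embed n (T (Ti xi))))) => [n|].
  rewrite hnorm_ge0/= TiK.
  have E : embed n (Ti xi) = act (@mxadj R q \o a) (act a (embed n (Ti xi))).
    rewrite -actM -[LHS]act1; congr act; apply/funext => x /=; exact: esym.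
  by rewrite [X in hnorm (_ - X)]E -actB hnormBC act_bound.
by rewrite -[X in _ --> X](mulr0 C); apply: cvgMr; exact: aT.
Qed.

Lemma sqrt_rate (u : nat -> R) C : (forall n, 0 <= u n) ->
  (forall n, u n ^+ 2 <= C / n.+1%:R) -> u @ \oo --> (0 : R).
Proof.
move=> u0 uC; apply: (@squeeze0 _ (fun n => Num.sqrt (C * harmonic n))) => [n|].
  by rewrite u0 /= -[leLHS]ger0_norm// -sqrtr_sqr ler_wsqrtr//.
rewrite -[X in _ --> X]sqrtr0; apply: continuous_cvg; first exact: sqrt_continuous.
by rewrite -[X in _ --> X](mulr0 C); apply: cvgMr; exact: cvg_harmonic.
Qed.

Lemma expi_grid (n j : nat) :
  expi (2 * pi * (q%:R * j%:R / n.+1%:R) / q%:R) = expi (2 * pi / n.+1%:R) ^+ j :> R[i].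
Proof.
rewrite -expiMn; congr expi; rewrite -[RHS]mulr_natr; field.
by rewrite nat1r !pnatr_eq0 -!lt0n /=.
Qed.

Lemma intertwines_U : intertwines (fun x => expi (2 * pi * x.1 / q%:R) *: U0 R q) U.
Proof.
move=> xi.
apply: (@sqrt_rate _ (q%:R * (4 * hnorm xi ^+ 2))) => n; first exact: hnorm_ge0.
pose Phi := orbit_coef (U xi).
(* Applying U to xi cancels one factor [Ui]; the shift in k1 survives only in the indicator. *)
have PhiS k1 k2 i : Phi k1.+1 k2 i = (q %| k1.+1 + i)%N%:R *: iter k2 Vi (iter k1 Ui xi).
  by rewrite /Phi /orbit_coef iterSr UK.
have hPhi k1 k2 i : hnorm (Phi k1 k2 i) <= hnorm xi.
  rewrite /Phi /orbit_coef; case: (_ %| _)%N.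
    by rewrite scale1r !hnorm_iso//; exact: iter_iso.
  by rewrite scale0r hnorm0 hnorm_ge0.
apply: le_trans (synth_shift1 n hPhi).
rewrite le_eqVlt; apply/orP; left; apply/eqP; congr (hnorm (_ - _) ^+ 2).
apply/ffunP => -[[j1 j2] i]; rewrite [LHS]ffunE [RHS]ffunE /=.
(* Row i of [U0] selects the component i + 1 mod q, whose indicator, q dividing k1 + i + 1, is the
   one in [PhiS]. *)
rewrite (bigD1 (ordS i))//= big1 ?addr0 => [|j ji]; last first.
  rewrite !mxE (_ : (i == ord_pred j) = false) ?mulr0 ?scale0r//.
  by apply: contraNF ji => /eqP ->; rewrite ord_predK.
rewrite !mxE ordSK eqxx mulr1 expi_grid; congr (_ *: _).
rewrite !ffunE; congr (_ *: _); apply: eq_bigr => k1 _; apply: eq_bigr => k2 _.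
by rewrite PhiS /orbit_coef /= /dvdn modnDmr addnS.
Qed.

Lemma UiV x : Ui (V x) = w^-1 *: V (Ui x).
Proof.
have w0 : w != 0.
  by apply/eqP => w0; have /eqP := wq; rewrite w0 expr0n gtn_eqF// eq_sym oner_eq0.
have -> : V (Ui x) = w *: Ui (V x) by rewrite -(linearfZ linUi) -{2}[x]UiK -UV UK.
by rewrite scalerA mulVf// scale1r.
Qed.

Lemma intertwines_V : intertwines (fun x => expi (2 * pi * x.2 / q%:R) *: diag_mx (\row_j w ^+ j)) V.
Proof.
move=> xi.
apply: (@sqrt_rate _ (q%:R * (4 * hnorm xi ^+ 2))) => n; first exact: hnorm_ge0.
pose Phi := orbit_coef (V xi).
have w0 : w != 0.
  by apply/eqP => w0; have /eqP := wq; rewrite w0 expr0n gtn_eqF// eq_sym oner_eq0.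
have UiVk k x : iter k Ui (V x) = w ^- k *: V (iter k Ui x).
  elim: k => [|k IH]; first by rewrite invr1 scale1r.
  by rewrite !iterS IH (linearfZ linUi) UiV scalerA exprSr invfM mulrC.
(* Moving V past k1 factors [Ui] produces w^-k1. Where the indicator is nonzero, q divides k1 + i,
   so that w^q = 1 turns this into w^i. *)
have PhiS k1 k2 i : Phi k1 k2.+1 i = w ^+ i *: orbit_coef xi k1 k2 i.
  rewrite /Phi /orbit_coef iterSr UiVk (linearfZ linVi) VK.
  rewrite (linearfZ (iter_linear _ linVi)) !scalerA; case: dvdnP => [[d kid]|]; last by rewrite mul0r mulr0 !scale0r.
  congr (_ *: _); rewrite mul1r mulr1; apply: (@mulfI _ (w ^+ k1)); first by rewrite expf_neq0.
  by rewrite divff ?expf_neq0// -exprD kid mulnC exprM wq expr1n.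
have hPhi k1 k2 i : hnorm (Phi k1 k2 i) <= hnorm xi.
  rewrite /Phi /orbit_coef; case: (_ %| _)%N.
    by rewrite scale1r !hnorm_iso//; exact: iter_iso.
  by rewrite scale0r hnorm0 hnorm_ge0.
apply: le_trans (synth_shift2 n hPhi).
rewrite le_eqVlt; apply/orP; left; apply/eqP; congr (hnorm (_ - _) ^+ 2).
apply/ffunP => -[[j1 j2] i]; rewrite [LHS]ffunE [RHS]ffunE /=.
rewrite (bigD1 i)//= big1 ?addr0 => [|j ji]; last first.
  by rewrite !mxE eq_sym (negbTE ji) mulr0n mulr0 scale0r.
rewrite !mxE eqxx mulr1n expi_grid -scalerA; congr (_ *: _).
rewrite !ffunE scalerA mulrC -scalerA; congr (_ *: _).
rewrite scaler_sumr; apply: eq_bigr => k1 _; rewrite scaler_sumr; apply: eq_bigr => k2 _.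
by rewrite PhiS !scalerA [w ^+ i * _]mulrC.
Qed.

End ApproximateIntertwiner.

(** * Multiplication operators on L2 *)

Section PeriodicFunctions.
Context {R : realType} {q : nat}.
Local Notation plane := (measurableTypeR R * measurableTypeR R)%type.

(* Measurability is recorded because it refers to the product sigma-algebra of
   the plane, for which continuity does not give it at once. *)
Definition regular_fun (u : R * R -> R) : Prop :=
  [/\ continuous u, measurable_fun setT (u : plane -> R),
      exists M, forall x, `|u x| <= M &
      forall x1 x2, u (x1, x2) = u (x1 + q%:R, x2) /\ u (x1, x2) = u (x1, x2 + q%:R)].

Lemma regular_fun_cst r : regular_fun (fun=> r).
Proof.
by split=> //; [exact: cst_continuous|exists `|r|].
Qed.

Lemma regular_funD u v : regular_fun u -> regular_fun v -> regular_fun (fun x => u x + v x).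
Proof.
move=> [cu mu [M hM] pu] [cv mv [N hN] pv]; split.
- by move=> x; apply: cvgD; [exact: cu|exact: cv].
- exact: measurable_funD.
- by exists (M + N) => x; rewrite (le_trans (ler_normD _ _))// lerD.
- by move=> x1 x2; rewrite -!(pu _ _).1 -!(pv _ _).1 -!(pu _ _).2 -!(pv _ _).2.
Qed.

Lemma regular_funM u v : regular_fun u -> regular_fun v -> regular_fun (fun x => u x * v x).
Proof.
move=> [cu mu [M hM] pu] [cv mv [N hN] pv]; split.
- by move=> x; apply: cvgM; [exact: cu|exact: cv].
- exact: measurable_funM.
- by exists (M * N) => x; rewrite normrM ler_pM.
- by move=> x1 x2; rewrite -!(pu _ _).1 -!(pv _ _).1 -!(pu _ _).2 -!(pv _ _).2.
Qed.

Lemma regular_funN u : regular_fun u -> regular_fun (fun x => - u x).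
Proof.
move=> gu; have := regular_funM (regular_fun_cst (-1)) gu; congr regular_fun.
by apply/funext => x; rewrite mulN1r.
Qed.

Lemma regular_fun_sum I (r : seq I) (F : I -> R * R -> R) : (forall i, regular_fun (F i)) ->
  regular_fun (fun x => \sum_(i <- r) F i x).
Proof.
move=> gF; elim: r => [|i r IH].
  by under eq_fun do rewrite big_nil; exact: regular_fun_cst.
by under eq_fun do rewrite big_cons; exact: regular_funD.
Qed.

(** Continuity follows from the usual three-term estimate, measurability and periodicity from
    pointwise convergence. This makes the regular symbols complete for uniform convergence. *)
Lemma regular_fun_lim (u : nat -> R * R -> R) v (e : nat -> R) : (forall n, regular_fun (u n)) ->
  (forall n x, `|u n x - v x| <= e n) -> e @ \oo --> (0 : R) -> regular_fun v.
Proof.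
move=> gu uv e0.
have ulim x : u n x @[n --> \oo] --> v x.
  apply/cvgrPdist_le => d d0; have /cvgr0Pnorm_le/(_ d d0) := e0.
  apply: filterS => n; rewrite distrC; apply: le_trans.
  by rewrite (le_trans (uv n x))// ler_norm.
split.
- move=> x; apply/cvgrPdist_le => d d0.
  have d3 : 0 < d / 3 by rewrite divr_gt0.
  have /cvgr0Pnorm_le/(_ _ d3)[n _ /(_ n (leqnn n)) hn] := e0.
  have {}hn y : `|u n y - v y| <= d / 3 := le_trans (uv n y) (le_trans (ler_norm _) hn).
  have [cu _ _ _] := gu n; have /cvgrPdist_le/(_ _ d3) := cu x.
  apply: filterS => y hy; rewrite (_ : d = d / 3 + (d / 3 + d / 3)); last by field.
  rewrite (_ : v x - v y = (v x - u n x) + ((u n x - u n y) + (u n y - v y))); last by ring.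
  rewrite (le_trans (ler_normD _ _))// lerD//; first by rewrite distrC.
  by rewrite (le_trans (ler_normD _ _))// lerD.
- apply: (@measurable_fun_cvg _ plane R setT u v) => [n|x _]; last exact: ulim.
  by have [] := gu n.
- have [_ _ [M hM] _] := gu 0%N; exists (M + e 0%N) => x.
  rewrite (_ : v x = u 0%N x - (u 0%N x - v x)); last by ring.
  by rewrite (le_trans (ler_normB _ _))// lerD.
- move=> x1 x2; split.
    have E n : u n (x1, x2) = u n (x1 + q%:R, x2).
      by have [_ _ _ h] := gu n; have [] := h x1 x2.
    by have := ulim (x1, x2); under eq_fun do rewrite E; move=> /cvg_unique; apply => //; exact: ulim.
  have E n : u n (x1, x2) = u n (x1, x2 + q%:R).
    by have [_ _ _ h] := gu n; have [] := h x1 x2.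
  by have := ulim (x1, x2); under eq_fun do rewrite E; move=> /cvg_unique; apply => //; exact: ulim.
Qed.

Definition regular_cfun (f : R * R -> R[i]) : Prop :=
  regular_fun (fun x => complex.Re (f x)) /\ regular_fun (fun x => complex.Im (f x)).

Lemma regular_cfun_cst c : regular_cfun (fun=> c).
Proof. by split; exact: regular_fun_cst. Qed.

Lemma regular_cfunD f g : regular_cfun f -> regular_cfun g -> regular_cfun (fun x => f x + g x).
Proof.
move=> [f1 f2] [g1 g2]; split.
  by under eq_fun do rewrite ReD; exact: regular_funD.
by under eq_fun do rewrite ImD; exact: regular_funD.
Qed.

Lemma regular_cfunM f g : regular_cfun f -> regular_cfun g -> regular_cfun (fun x => f x * g x).
Proof.
move=> [f1 f2] [g1 g2].
have E x : f x * g x =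
    (complex.Re (f x) * complex.Re (g x) + - (complex.Im (f x) * complex.Im (g x))) +i*
    (complex.Re (f x) * complex.Im (g x) + complex.Im (f x) * complex.Re (g x)).
  by case: (f x) (g x) => [? ?] [? ?].
split; under eq_fun do rewrite E /=.
  by apply: regular_funD; [|apply: regular_funN]; exact: regular_funM.
by apply: regular_funD; exact: regular_funM.
Qed.

Lemma regular_cfun_conj f : regular_cfun f -> regular_cfun (fun x => (f x)^*%C).
Proof.
move=> [f1 f2]; split.
  by under eq_fun do rewrite Re_conjc.
have E x : complex.Im (f x)^*%C = - complex.Im (f x) by case: (f x).
by under eq_fun do rewrite E; exact: regular_funN.
Qed.

Lemma regular_cfun_sum I (r : seq I) (F : I -> R * R -> R[i]) : (forall i, regular_cfun (F i)) ->
  regular_cfun (fun x => \sum_(i <- r) F i x).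
Proof.
move=> gF; elim: r => [|i r IH].
  by under eq_fun do rewrite big_nil; exact: regular_cfun_cst.
by under eq_fun do rewrite big_cons; exact: regular_cfunD.
Qed.

Lemma regular_cfun_normsq f : regular_cfun f -> regular_fun (fun x => normc (f x) ^+ 2).
Proof.
move=> [f1 f2]; under eq_fun do rewrite sqr_normcE !expr2.
by apply: regular_funD; exact: regular_funM.
Qed.

Lemma regular_cfun_lim (u : nat -> R * R -> R[i]) v (e : nat -> R) : (forall n, regular_cfun (u n)) ->
  (forall n x, normc (u n x - v x) <= e n) -> e @ \oo --> (0 : R) -> regular_cfun v.
Proof.
move=> gu uv e0; split.
  apply: (regular_fun_lim (fun n => (gu n).1) _ e0) => n x.
  by rewrite (le_trans _ (uv n x))// -ReN -ReD Re_le_normc.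
apply: (regular_fun_lim (fun n => (gu n).2) _ e0) => n x.
by rewrite (le_trans _ (uv n x))// -ImN -ImD Im_le_normc.
Qed.

Lemma regular_cfun_bounded f : regular_cfun f -> exists2 M, 0 <= M & forall x, normc (f x) <= M.
Proof.
move=> [[_ _ [M hM] _] [_ _ [N hN] _]].
have M0 : 0 <= M := le_trans (normr_ge0 _) (hM (0, 0)).
have N0 : 0 <= N := le_trans (normr_ge0 _) (hN (0, 0)).
exists (M + N) => [|x]; first exact: addr_ge0.
rewrite -ler_sqr ?nnegrE ?normc_ge0 ?addr_ge0// sqr_normcE.
apply: (@le_trans _ _ (M ^+ 2 + N ^+ 2)).
  by rewrite lerD// -[leLHS]real_normK ?num_real// ler_sqr ?nnegrE.
by rewrite sqrrD addrAC lerDl mulrn_wge0// mulr_ge0.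
Qed.

Definition regular_symbol (a : R * R -> 'M[R[i]]_q) : Prop :=
  forall i j, regular_cfun (fun x => a x i j).

Lemma regular_symbol_cst M : regular_symbol (fun=> M).
Proof. by move=> i j; exact: regular_cfun_cst. Qed.

Lemma regular_symbol_lin (c : R[i]) a b : regular_symbol a -> regular_symbol b -> regular_symbol (fun x => c *: a x + b x).
Proof.
move=> ga gb i j; under eq_fun do rewrite !mxE.
by apply: regular_cfunD => //; apply: regular_cfunM => //; exact: regular_cfun_cst.
Qed.

Lemma regular_symbolB a b : regular_symbol a -> regular_symbol b -> regular_symbol (fun x => a x - b x).
Proof.
move=> ga gb; have := regular_symbol_lin (-1) gb ga; congr regular_symbol; apply/funext => x.
by rewrite scaleN1r addrC.
Qed.

Lemma regular_symbolM a b : regular_symbol a -> regular_symbol b -> regular_symbol (fun x => a x *m b x).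
Proof.
move=> ga gb i j; under eq_fun do rewrite mxE.
by apply: regular_cfun_sum => k; exact: regular_cfunM.
Qed.

Lemma regular_symbol_adj a : regular_symbol a -> regular_symbol (@mxadj R q \o a).
Proof.
by move=> ga i j; under eq_fun do rewrite !mxE; exact: regular_cfun_conj.
Qed.

Lemma vnormsq_ge0 n (v : 'cV[R[i]]_n) : 0 <= vnormsq v.
Proof. by apply: sumr_ge0 => i _; exact: sqr_ge0. Qed.

(** Each coordinate of M v is at most q K |v|. Summing q squares costs a further factor q, enlarged
    to q^2 to avoid a square root; only the linear dependence on K matters later. *)
Lemma mx_bound_entries (M : 'M[R[i]]_q) K : 0 <= K ->
  (forall i j, normc (M i j) <= K) -> mx_bound M (q%:R * (q%:R * K)).
Proof.
move=> K0 MK v; pose s := Num.sqrt (vnormsq v).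
have vs j : normc (v j 0) <= s.
  rewrite -[leLHS]ger0_norm ?normc_ge0// -sqrtr_sqr ler_wsqrtr//.
  by rewrite /vnormsq (bigD1 j)//= lerDl sumr_ge0// => i _; rewrite sqr_ge0.
have s0 : 0 <= s := sqrtr_ge0 _.
have Mv i : normc ((M *m v) i 0) <= q%:R * (K * s).
  rewrite mxE; apply: le_trans (_ : \sum_j normc (M i j * v j 0) <= _).
    elim/big_ind2 : _ => [|x1 x2 y1 y2 h1 h2|//]; first by rewrite normc0.
    by rewrite (le_trans (le_normcD _ _))// lerD.
  rewrite mulr_natl -[q in _ *+ q]card_ord -sumr_const; apply: ler_sum => j _.
  by rewrite normcM ler_pM ?normc_ge0.
rewrite -(sqr_sqrtr (vnormsq_ge0 v)) -/s -exprMn.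
apply: le_trans (_ : \sum_(i < q) (q%:R * (K * s)) ^+ 2 <= _).
  apply: ler_sum => i _.
  by rewrite ler_sqr ?nnegrE ?normc_ge0 ?mulr_ge0.
rewrite sumr_const card_ord -[leLHS]mulr_natl.
rewrite (_ : (q%:R * (q%:R * K) * s) ^+ 2 = (q%:R * q%:R) * (q%:R * (K * s)) ^+ 2); last by ring.
rewrite ler_wpM2r ?sqr_ge0// -natrM ler_nat.
by case: (q) => // m; rewrite leq_pmulr.
Qed.

Lemma regular_symbol_bounded a : regular_symbol a -> exists2 C, 0 <= C & forall x, mx_bound (a x) C.
Proof.
move=> ga.
have /choice[K hK] : forall ij : 'I_q * 'I_q, exists M, 0 <= M /\ forall x, normc (a x ij.1 ij.2) <= M.
  by move=> ij; have [M M0 hM] := regular_cfun_bounded (ga ij.1 ij.2); exists M.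
have K0 : 0 <= \sum_ij K ij by apply: sumr_ge0 => ij _; have [] := hK ij.
exists (q%:R * (q%:R * \sum_ij K ij)) => [|x]; first by rewrite !mulr_ge0.
apply: mx_bound_entries => // i j.
have [_ h] := hK (i, j); rewrite (le_trans (h x))// (bigD1 (i, j))//=.
by rewrite lerDl sumr_ge0// => kl _; have [] := hK kl.
Qed.

(** An entry is a coordinate of the image of a basis vector. *)
Lemma mx_bound_entry (M : 'M[R[i]]_q) C : 0 <= C -> mx_bound M C ->
  forall i j, normc (M i j) <= C.
Proof.
move=> C0 MC i j; rewrite -ler_sqr ?nnegrE ?normc_ge0//.
have := MC (delta_mx j 0); rewrite /vnormsq [X in _ * X](bigD1 j)//= [X in _ * (_ + X)]big1.
  rewrite addr0 mxE !eqxx normc1 expr1n mulr1; apply: le_trans.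
  rewrite (bigD1 i)//= -colE mxE lerDl.
  by apply: sumr_ge0 => k _; exact: sqr_ge0.
by move=> k kj; rewrite mxE (negbTE kj) normc0 expr0n.
Qed.

Lemma regular_symbol_continuous a : regular_symbol a -> periodic_matrix_fun a.
Proof.
move=> ga; split; last first.
  move=> x1 x2; split; apply/matrixP => i j; apply/eqP; rewrite eq_complex;
    have [[_ _ _ h1] [_ _ _ h2]] := ga i j;
    have [h11 h12] := h1 x1 x2; have [h21 h22] := h2 x1 x2.
    by rewrite h11 h21 !eqxx.
  by rewrite h12 h22 !eqxx.
move=> x; apply/cvg_mx_entourageP => A; rewrite -entourage_ballE => -[e /= e0 eA].
apply: filter_forall => i; apply: filter_forall => j.
(* Radii of balls in R[i]^o are elements of R[i]; being positive forces e to be real. *)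
have [r r0 re] : exists2 r : R, 0 < r & e = r%:C.
  move: e0; rewrite ltcE /= => /andP[/eqP h h']; exists (complex.Re e) => //.
  by case: (e) h => ? ? /= ->.
have r2 : 0 < r / 2 by rewrite divr_gt0.
have [[c1 _ _ _] [c2 _ _ _]] := ga i j.
have /cvgrPdist_lt/(_ _ r2) h1 := c1 x; have /cvgrPdist_lt/(_ _ r2) h2 := c2 x.
apply: filterS2 h1 h2 => y h1 h2; apply/mem_set/eA; rewrite re /ball /=.
suff : (normc (a x i j - a y i j))%:C < r%:C :> R[i] by [].
rewrite ltcR -ltr_sqr ?nnegrE ?normc_ge0 ?(ltW r0)// sqr_normcE !(ReD, ImD, ReN, ImN).
apply: (@le_lt_trans _ _ ((r / 2) ^+ 2 + (r / 2) ^+ 2)).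
  by rewrite lerD// -[leLHS]real_normK ?num_real// ler_sqr ?nnegrE ?normr_ge0 ?(ltW r2) ?(ltW h1) ?(ltW h2).
rewrite (_ : _ + _ = r ^+ 2 / 2); last by field.
by rewrite ltr_pdivrMr// ltr_pMr ?exprn_gt0// ltr1n.
Qed.

End PeriodicFunctions.

(** * Multiplication by a regular symbol: algebra, adjoint and norm *)

Section MultiplicationOperators.
Context {R : realType} {q : nat}.
Local Notation plane := (measurableTypeR R * measurableTypeR R)%type.
Local Notation mu := (plane_measure R).
Local Notation sqf := (sqint_fun mu q).
Local Notation piL := (\pi_(L2 mu q)).
Implicit Types (a b : R * R -> 'M[R[i]]_q) (f g : sqf) (C : R).

Lemma Lfun2_bounded_mul (u f : plane -> R) M : measurable_fun setT u ->
  (forall x, `|u x| <= M) -> f \in Lfun mu 2%:E -> (fun x => u x * f x) \in Lfun mu 2%:E.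
Proof.
move=> mu_ uM /Lfun2P[mf fi]; apply/Lfun2P; split; first exact: measurable_funM.
apply: (@le_lt_trans _ _ (\int[mu]_x ((M ^+ 2)%:E * ((f x) ^+ 2)%:E))%E).
  apply: ge0_le_integral => //.
  - by move=> x _; rewrite lee_fin sqr_ge0.
  - by apply: measurable_sqr; exact: measurable_funM.
  - by apply: measurable_funeM; exact: measurable_sqr.
  - move=> x _; rewrite -EFinM lee_fin exprMn ler_wpM2r ?sqr_ge0//.
    rewrite -[leLHS]real_normK ?num_real// ler_sqr ?nnegrE//.
    exact: le_trans (uM x).
rewrite ge0_integralZl//.
- by rewrite lte_mul_pinfty// ?lee_fin ?sqr_ge0.
- exact: measurable_sqr.
- by move=> x _; rewrite lee_fin sqr_ge0.
- by rewrite lee_fin sqr_ge0.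
Qed.

Lemma Re_sum I (r : seq I) (F : I -> R[i]) :
  complex.Re (\sum_(i <- r) F i) = \sum_(i <- r) complex.Re (F i).
Proof. by apply: (big_morph _ (@ReD R)). Qed.

Lemma Im_sum I (r : seq I) (F : I -> R[i]) :
  complex.Im (\sum_(i <- r) F i) = \sum_(i <- r) complex.Im (F i).
Proof. by apply: (big_morph _ (@ImD R)). Qed.

Lemma Lfun2_sum I (r : seq I) (F : I -> plane -> R) :
  (forall i, F i \in Lfun mu 2%:E) -> (fun x => \sum_(i <- r) F i x) \in Lfun mu 2%:E.
Proof.
move=> LF; elim: r => [|i r IH].
  by under eq_fun do rewrite big_nil; exact: Lfun20.
by under eq_fun do rewrite big_cons; exact: Lfun2D.
Qed.

(** Ensures that the default value of [insubd] in [mulop] is not reached for regular symbols. *)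
Lemma regular_symbol_mul a f : regular_symbol a -> exists g, forall x, g x = a x *m f x.
Proof.
move=> ga; suff h : (fun x : plane => a x *m f x) \in @sqint _ _ _ mu q by exists (SqintFun h).
apply/sqintP => i.
have gM (u : plane -> R) h : regular_fun u (q := q) -> h \in Lfun mu 2%:E ->
    (fun x => u x * h x) \in Lfun mu 2%:E.
  by move=> [_ mu_ [M hM] _] Lh; exact: Lfun2_bounded_mul mu_ hM Lh.
have E x : (a x *m f x) i 0 = \sum_j
    ((complex.Re (a x i j) * complex.Re (f x j 0) - complex.Im (a x i j) * complex.Im (f x j 0)) +i*
     (complex.Re (a x i j) * complex.Im (f x j 0) + complex.Im (a x i j) * complex.Re (f x j 0))).
  rewrite mxE; apply: eq_bigr => j _.
  by case: (a x i j) (f x j 0) => [? ?] [? ?].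
split; under eq_fun do rewrite E ?Re_sum ?Im_sum /=.
  apply: Lfun2_sum => j; have /sqintP/(_ j)[f1 f2] := valP f; have [a1 a2] := ga i j.
  by apply: Lfun2B; exact: gM.
apply: Lfun2_sum => j; have /sqintP/(_ j)[f1 f2] := valP f; have [a1 a2] := ga i j.
by apply: Lfun2D; exact: gM.
Qed.

(** [mulop] goes through a chosen representative; since equality almost everywhere survives
    multiplication by a, it can be computed on any representative. All identities for [mulop] reduce
    to matrix identities this way. *)
Lemma mulop_pi a f g : (forall x, g x = a x *m f x) -> regular_symbol a ->
  mulop a (piL f) = piL g.
Proof.
move=> gE ga; apply/eqP/L2_eqP; have [h hE] := regular_symbol_mul (repr (piL f)) ga.
have -> : insubd (0 : sqf) (fun x : plane => a x *m (repr (piL f) : sqf) x) = h.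
  by rewrite -[RHS](valKd (0 : sqf)); congr insubd; apply/funext => x; rewrite /= hE.
by apply: filterS (repr_pi_ae f) => x /= fx; rewrite hE gE fx.
Qed.

Lemma mulop_linear a : regular_symbol a -> linear (mulop a : Hq R q -> Hq R q).
Proof.
move=> ga c; elim/quotW => f; elim/quotW => g.
have [f' fE] := regular_symbol_mul f ga; have [g' gE] := regular_symbol_mul g ga.
rewrite (mulop_pi fE ga) (mulop_pi gE ga) -!pi_linear.
by apply: mulop_pi => // x; rewrite /= !fctE fE gE mulmxDr -scalemxAr.
Qed.

Lemma mulop_lin2 (c : R[i]) a b : regular_symbol a -> regular_symbol b ->
  mulop (fun x => c *: a x + b x) = c *: mulop a + mulop b.
Proof.
move=> ga gb; apply/funext; elim/quotW => f.
have [f' fE] := regular_symbol_mul f ga; have [g' gE] := regular_symbol_mul f gb.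
rewrite !fctE (mulop_pi fE ga) (mulop_pi gE gb) -pi_linear.
apply: mulop_pi; last exact: regular_symbol_lin.
by move=> x; rewrite /= !fctE fE gE mulmxDl -scalemxAl.
Qed.

Lemma mulopB a b : regular_symbol a -> regular_symbol b ->
  mulop (fun x => a x - b x) = mulop a - mulop b :> (Hq R q -> Hq R q).
Proof.
move=> ga gb; transitivity (-1 *: mulop b + mulop a : Hq R q -> Hq R q).
  rewrite -(mulop_lin2 (-1) gb ga); congr mulop; apply/funext => x.
  by rewrite scaleN1r addrC.
by rewrite scaleN1r addrC.
Qed.

Lemma mulop0 : mulop (fun=> 0) = 0 :> (Hq R q -> Hq R q).
Proof.
rewrite -[RHS](subrr (mulop (fun=> 0))) -mulopB; try exact: regular_symbol_cst.
by congr mulop; apply/funext => x; rewrite subr0.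
Qed.

Lemma mulopM a b : regular_symbol a -> regular_symbol b ->
  mulop (fun x => a x *m b x) = mulop a \o mulop b.
Proof.
move=> ga gb; apply/funext; elim/quotW => f.
have [g gE] := regular_symbol_mul f gb; have [h hE] := regular_symbol_mul g ga.
rewrite /= (mulop_pi gE gb) (mulop_pi hE ga).
apply: mulop_pi; last exact: regular_symbolM.
by move=> x; rewrite hE gE mulmxA.
Qed.

Lemma mulop1 : mulop (fun=> 1%:M) = idfun :> (Hq R q -> Hq R q).
Proof.
apply/funext; elim/quotW => f; apply: mulop_pi; last exact: regular_symbol_cst.
by move=> x; rewrite mul1mx.
Qed.

Lemma mulop_adjoint a : regular_symbol a -> adjoint (mulop a : Hq R q -> Hq R q) (mulop (@mxadj R q \o a)).
Proof.
move=> ga; elim/quotW => f; elim/quotW => g.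
have ga' := regular_symbol_adj ga.
have [f' fE] := regular_symbol_mul f ga; have [g' gE] := regular_symbol_mul g ga'.
rewrite (mulop_pi fE ga) (mulop_pi gE ga') /inner /= !L2_inner_pi.
congr cintegral; apply/funext => x; rewrite /pointwise_dot fE gE.
under eq_bigr do rewrite mxE mulr_suml.
rewrite exchange_big; apply: eq_bigr => j _ /=.
rewrite mxE (rmorph_sum (@conjc R)) mulr_sumr; apply: eq_bigr => i _ /=.
rewrite conjcM !mxE conjcK mulrA; congr (_ * _); exact: mulrC.
Qed.

Lemma normsqE (f : plane -> 'cV[R[i]]_q) x : normsq f x = vnormsq (f x).
Proof. by apply: eq_bigr => i _; rewrite sqr_normcE. Qed.

Lemma mulop_bound a C : regular_symbol a -> 0 <= C -> (forall x, mx_bound (a x) C) ->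
  op_bound (mulop a : Hq R q -> Hq R q) C.
Proof.
move=> ga C0 aC; elim/quotW => f; have [g gE] := regular_symbol_mul f ga.
rewrite (mulop_pi gE ga) -ler_sqr ?nnegrE ?mulr_ge0 ?hnorm_ge0// exprMn.
rewrite -lee_fin (EFinM (C ^+ 2)) !hnorm_L2.
have mN (h : sqf) : measurable_fun setT (fun x => (normsq h x)%:E).
  by have /integrableP[] := normsq_integrable h.
rewrite -ge0_integralZl//.
- apply: ge0_le_integral => //.
  + by move=> x _; rewrite lee_fin normsq_ge0.
  + exact: measurable_funeM.
  + by move=> x _; rewrite -EFinM lee_fin !normsqE gE; exact: aC.
- by move=> x _; rewrite lee_fin normsq_ge0.
- by rewrite lee_fin sqr_ge0.
Qed.

Lemma indic_Lfun2 (Q : set plane) : measurable Q -> (mu Q < +oo)%E ->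
  (\1_Q : plane -> R) \in Lfun mu 2%:E.
Proof.
move=> mQ Qoo; apply/Lfun2P; split; first exact: measurable_indic.
rewrite (eq_integral (fun x => (\1_Q x)%:E)) => [|x _]; last first.
  by rewrite indicE; case: (_ \in _); rewrite ?expr1n ?expr0n.
by rewrite integral_indic// setIT.
Qed.

Lemma plane_measure_rect (A B : set (measurableTypeR R)) :
  measurable A -> measurable B ->
  mu (A `*` B) = (lebesgue_measure A * lebesgue_measure B)%E.
Proof. by move=> mA mB; exact: product_measure1E. Qed.

Lemma vnormsqZ n (r : R) (v : 'cV[R[i]]_n) : vnormsq (r%:C *: v) = r ^+ 2 * vnormsq v.
Proof.
rewrite /vnormsq mulr_sumr; apply: eq_bigr => i _.
by rewrite mxE normcM normc_real exprMn real_normK ?num_real.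
Qed.

(* Test the operator on [1_Q v] for a small square Q around the point. *)
Lemma mulop_bound_pointwise a C : regular_symbol a -> 0 <= C ->
  op_bound (mulop a : Hq R q -> Hq R q) C -> forall x, mx_bound (a x) C.
Proof.
move=> ga C0 aC x v; rewrite leNgt; apply/negP => lt.
pose g (y : R * R) := vnormsq (a y *m v).
(* A value strictly between K and g x: g stays above it near x, so a strict gap remains after
   integrating over Q. *)
pose K := C ^+ 2 * vnormsq v; pose K' := (K + g x) / 2.
have ltK : K < K' by rewrite /K' ltr_pdivlMr// mulr_natr mulr2n ltrD2l.
have ltK' : K' < g x by rewrite /K' ltr_pdivrMr// mulr_natr mulr2n ltrD2r.
have [cg mg _ _] : regular_fun g (q := q).
  apply: regular_fun_sum => i; apply: regular_cfun_normsq.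
  under eq_fun do rewrite mxE.
  by apply: regular_cfun_sum => j; apply: regular_cfunM => //; exact: regular_cfun_cst.
have /nbhs_ballP[e /= e0 he] : \forall y \near x, K' < g y.
  exact: (cvgr_gt (g x) (cg x) K').
pose Q : set plane := ball x.1 e `*` ball x.2 e.
have mQ : measurable Q by apply: measurableX; exact: measurable_ball.
have muQ : mu Q = ((e *+ 2) ^+ 2)%:E.
  rewrite plane_measure_rect; try exact: measurable_ball.
  by rewrite !lebesgue_measure_ball ?ltW// -EFinM.
have Qlt : (mu Q < +oo)%E by rewrite muQ ltry.
have m0 : 0 < (e *+ 2) ^+ 2 by rewrite exprn_gt0// mulrn_wgt0.
have f0S : (fun y : plane => (\1_Q y)%:C *: v) \in @sqint _ _ _ mu q.
  apply/sqintP => i.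
  have E y : ((\1_Q y)%:C *: v) i 0 = (complex.Re (v i 0) * \1_Q y) +i* (complex.Im (v i 0) * \1_Q y).
    rewrite mxE; case: (v i 0) => r s /=; apply/eqP; rewrite eq_complex /=.
    by rewrite !mul0r subr0 addr0 mulrC eqxx mulrC eqxx.
  by split; under eq_fun do rewrite E /=; apply: Lfun2Z; exact: indic_Lfun2.
pose f := SqintFun f0S; have [h hE] := regular_symbol_mul f ga.
have := aC (piL f); rewrite (mulop_pi hE ga).
rewrite -ler_sqr ?nnegrE ?mulr_ge0 ?hnorm_ge0// exprMn.
rewrite -lee_fin (EFinM (C ^+ 2)) !hnorm_L2.
have int_indic (r : R) : 0 <= r -> (\int[mu]_y (r%:E * (\1_Q y)%:E))%E = (r * (e *+ 2) ^+ 2)%:E.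
  move=> r0; rewrite ge0_integralZl//; last exact/measurable_EFinP/measurable_indic.
  by rewrite integral_indic// setIT EFinM muQ.
have -> : (\int[mu]_y (normsq f y)%:E)%E = (vnormsq v * (e *+ 2) ^+ 2)%:E.
  rewrite -int_indic ?vnormsq_ge0//; apply: eq_integral => y _.
  rewrite normsqE /= vnormsqZ -EFinM mulrC; congr (_ * _)%:E.
  by rewrite indicE; case: (_ \in _); rewrite ?expr1n ?expr0n.
apply/negP; rewrite -ltNge.
apply: (@lt_le_trans _ _ (K' * (e *+ 2) ^+ 2)%:E).
  by rewrite -EFinM lte_fin mulrA ltr_pM2r.
have K'0 : 0 <= K' by rewrite (le_trans _ (ltW ltK))// mulr_ge0 ?sqr_ge0 ?vnormsq_ge0.
rewrite -int_indic//; apply: ge0_le_integral => //.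
- by move=> y _; rewrite -EFinM lee_fin mulr_ge0.
- by apply: measurable_funeM; exact/measurable_EFinP/measurable_indic.
- by have /integrableP[] := normsq_integrable h.
- move=> y _; rewrite -EFinM lee_fin normsqE hE /= -scalemxAr vnormsqZ indicE.
  have [yQ|_] := boolP (y \in Q); last by rewrite mulr0 expr0n mul0r.
  rewrite mulr1 expr1n mul1r; apply/ltW/he.
  by move/set_mem: yQ => [].
Qed.

End MultiplicationOperators.

(** * The symbols of the two generators *)

Section Generators.
Context {R : realType} {p q : nat}.
Hypothesis q_gt0 : (0 < q)%N.
Local Notation w := (omega R p q).
Local Notation plane := (measurableTypeR R * measurableTypeR R)%type.

Lemma omega_order : w ^+ q = 1.
Proof.
rewrite /omega -expiMn -[X in expi X]mulr_natr divfK ?pnatr_eq0 -?lt0n//.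
by rewrite mulr_natr expiMn expi_2pi expr1n.
Qed.

Lemma regular_fun_plane1 (f : R -> R) : continuous f -> (forall x, `|f x| <= 1) ->
  (forall t, f (t + 2 * pi) = f t) ->
  regular_fun (q := q) (fun x => f (2 * pi * x.1 / q%:R)).
Proof.
move=> cf f1 fp.
have cl : continuous (fun t : R => 2 * pi * t / q%:R).
  move=> t; apply: cvgM; last exact: cvg_cst.
  by apply: cvgM; [exact: cvg_cst|exact: cvg_id].
have cfl : continuous (f \o (fun t : R => 2 * pi * t / q%:R)).
  by move=> t; apply: continuous_comp; [exact: cl|exact: cf].
split.
- have : continuous ((f \o (fun t : R => 2 * pi * t / q%:R)) \o (@fst R R)).
    by move=> x; apply: continuous_comp; [exact: cvg_fst|exact: cfl].
  exact.
(* Measurability for the product sigma-algebra is obtained from the projection and continuity on the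
   line. *)
- exact: measurableT_comp (continuous_measurable_fun cfl) measurable_fst.
- by exists 1 => x; exact: f1.
- move=> x1 x2; split=> //=; rewrite -[LHS]fp; congr f; field.
  by rewrite pnatr_eq0 -lt0n.
Qed.

Lemma regular_fun_plane2 (f : R -> R) : continuous f -> (forall x, `|f x| <= 1) ->
  (forall t, f (t + 2 * pi) = f t) ->
  regular_fun (q := q) (fun x => f (2 * pi * x.2 / q%:R)).
Proof.
move=> cf f1 fp; have [c m [M hM] h] := regular_fun_plane1 cf f1 fp.
pose sw (x : R * R) := (x.2, x.1).
split.
- have : continuous ((fun x => f (2 * pi * x.1 / q%:R)) \o sw).
    by move=> x; apply: continuous_comp; [exact: (@swap_continuous R R)|exact: c].
  exact.
- have ms : measurable_fun setT (sw : plane -> plane).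
    exact: measurable_fun_pair measurable_snd measurable_fst.
  exact: (measurableT_comp m ms).
- by exists M => x; exact: (hM (sw x)).
- by move=> x1 x2; have [h1 h2] := h x2 x1; split.
Qed.

Lemma regular_cfun_expi1 : regular_cfun (q := q) (fun x : R * R => expi (2 * pi * x.1 / q%:R)).
Proof.
split; apply: regular_fun_plane1.
- exact: continuous_cos.
- by move=> x; rewrite ler_norml cos_geN1 cos_le1.
- by move=> t; rewrite mulr_natl cosD cos2pi sin2pi mulr1 mulr0 subr0.
- exact: continuous_sin.
- by move=> x; rewrite ler_norml sin_geN1 sin_le1.
- by move=> t; rewrite mulr_natl sinD cos2pi sin2pi mulr1 mulr0 addr0.
Qed.

Lemma regular_cfun_expi2 : regular_cfun (q := q) (fun x : R * R => expi (2 * pi * x.2 / q%:R)).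
Proof.
split; apply: regular_fun_plane2.
- exact: continuous_cos.
- by move=> x; rewrite ler_norml cos_geN1 cos_le1.
- by move=> t; rewrite mulr_natl cosD cos2pi sin2pi mulr1 mulr0 subr0.
- exact: continuous_sin.
- by move=> x; rewrite ler_norml sin_geN1 sin_le1.
- by move=> t; rewrite mulr_natl sinD cos2pi sin2pi mulr1 mulr0 addr0.
Qed.

Definition symbolU (x : R * R) : 'M[R[i]]_q := expi (2 * pi * x.1 / q%:R) *: U0 R q.
Definition symbolV (x : R * R) : 'M[R[i]]_q := expi (2 * pi * x.2 / q%:R) *: V0 R p q.

Lemma regular_symbolU : regular_symbol symbolU.
Proof.
move=> i j; under eq_fun do rewrite mxE.
by apply: regular_cfunM; [exact: regular_cfun_expi1|exact: regular_cfun_cst].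
Qed.

Lemma regular_symbolV : regular_symbol symbolV.
Proof.
move=> i j; under eq_fun do rewrite mxE.
by apply: regular_cfunM; [exact: regular_cfun_expi2|exact: regular_cfun_cst].
Qed.

Lemma mxadjZ (c : R[i]) (M : 'M[R[i]]_q) : mxadj (c *: M) = c^*%C *: mxadj M.
Proof. by apply/matrixP => i j; rewrite !mxE conjcM. Qed.

Lemma unitary_scale t (M : 'M[R[i]]_q) : mxadj M *m M = 1%:M ->
  mxadj (expi t *: M) *m (expi t *: M) = 1%:M.
Proof.
move=> MM; rewrite mxadjZ -scalemxAl -scalemxAr MM scalerA mulrC.
by rewrite expi_conjM scale1r.
Qed.

Lemma U0_unitary : mxadj (U0 R q) *m U0 R q = 1%:M.
Proof.
apply/matrixP => i j; rewrite !mxE (bigD1 (ord_pred i))//= big1 => [|k ki].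
  rewrite !mxE eqxx conjc1 mul1r addr0 (inj_eq (can_inj (@ord_predK q))).
  by case: eqP.
by rewrite !mxE (negbTE ki) conjc0 mul0r.
Qed.

Lemma V0_unitary : mxadj (V0 R p q) *m V0 R p q = 1%:M.
Proof.
apply/matrixP => i j; rewrite !mxE (bigD1 i)//= big1 => [|k ki].
  rewrite !mxE eqxx mulr1n addr0; have [_|_] := eqVneq i j.
    by rewrite mulr1n /omega -expiMn mulrC expi_conjM.
  by rewrite mulr0n mulr0.
by rewrite !mxE (negbTE ki) conjc0 mul0r.
Qed.

Lemma symbolU_unitary x : mxadj (symbolU x) *m symbolU x = 1%:M.
Proof. exact: unitary_scale U0_unitary. Qed.

Lemma symbolV_unitary x : mxadj (symbolV x) *m symbolV x = 1%:M.
Proof. exact: unitary_scale V0_unitary. Qed.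

Lemma symbol_commutation x : symbolU x *m symbolV x = w *: (symbolV x *m symbolU x).
Proof.
rewrite -!scalemxAl -!scalemxAr !scalerA; apply/matrixP => i j.
rewrite !mxE (bigD1 j)//= [X in _ * (_ + X)]big1 => [|k kj]; last first.
  by rewrite !mxE (negbTE kj) mulr0n mulr0.
rewrite (bigD1 i)//= [X in _ = _ * (_ + X)]big1 => [|k ki]; last first.
  by rewrite !mxE eq_sym (negbTE ki) mulr0n mul0r.
rewrite !mxE !eqxx !mulr1n !addr0; have [->|_] := eqVneq i (ord_pred j); last first.
  by rewrite mul0r !mulr0.
(* For j = 0 the predecessor is q - 1, and the identity becomes w^q = 1. *)
have -> : w ^+ j = w * w ^+ ord_pred j; last by ring.
rewrite /= (expr_mod _ omega_order) -exprS prednK ?exprD ?omega_order ?mulr1//.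
by rewrite addn_gt0 q_gt0 orbT.
Qed.

Lemma mulop_unitary a : regular_symbol a -> (forall x, mxadj (a x) *m a x = 1%:M) ->
  unitary_op (mulop a : Hq R q -> Hq R q).
Proof.
move=> ga aa; have ga' := regular_symbol_adj ga; split.
  have [C C0 aC] := regular_symbol_bounded ga.
  apply: (@op_bound_bounded _ _ _ C); [exact: mulop_linear|exact: mulop_bound].
exists (mulop (@mxadj R q \o a)); split; first exact: mulop_adjoint.
  rewrite -mulopM// -mulop1; congr mulop; apply/funext => x /=.
  exact: mulmx1C.
by rewrite -mulopM// -mulop1; congr mulop; apply/funext => x /=.
Qed.

End Generators.

(** * Limits of operators *)

Lemma null_le (R : realType) (e : nat -> R) d : e @ \oo --> (0 : R) -> 0 < d ->
  exists N, forall n, (N <= n)%N -> e n <= d.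
Proof.
move=> e0 d0; have /cvgr0Pnorm_le/(_ d d0)[N _ hN] := e0.
by exists N => n Nn; rewrite (le_trans (ler_norm _))// hN.
Qed.

(** Completeness of H gives pointwise limits. Writing the Cauchy bound as e m + e n lets m tend to
    infinity and leaves exactly e n. *)
Lemma operator_limit (R : realType) (H : hilbertType R) (T : nat -> H -> H)
    (e : nat -> R) : (forall n, linear (T n)) ->
  (forall m n, op_bound (T m - T n) (e m + e n)) -> e @ \oo --> (0 : R) ->
  exists T', linear T' /\ forall n, op_bound (T n - T') (e n).
Proof.
move=> lT cT e0.
have /choice[T' hT'] : forall x, exists l, forall d, 0 < d ->
    exists N, forall n, (N <= n)%N -> hnorm (T n x - l) < d.
  move=> x; apply: hilbert_complete => d d0.
  have d0' : 0 < d / (2 * hnorm x + 1).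
    by rewrite divr_gt0// ltr_wpDl// mulr_ge0 ?hnorm_ge0.
  have [N hN] := null_le e0 d0'; exists N => m n Nm Nn.
  apply: le_lt_trans (cT m n x) _.
  apply: (@le_lt_trans _ _ ((d / (2 * hnorm x + 1) + d / (2 * hnorm x + 1)) * hnorm x)).
    by rewrite ler_wpM2r ?hnorm_ge0// lerD ?hN.
  rewrite (_ : _ * _ = d * (2 * hnorm x) / (2 * hnorm x + 1)); last by ring.
  rewrite ltr_pdivrMr ?ltr_wpDl ?mulr_ge0 ?hnorm_ge0//.
  by rewrite ltr_pM2l// ltrDl.
have bT' n : op_bound (T n - T') (e n).
  move=> x; rewrite -subr_le0; apply: (@le0_of_small _ _ (hnorm x + 1)) => d d0.
  have [N hN] := null_le e0 d0; have [N' hN'] := hT' x d d0.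
  pose m := maxn N N'; have := hN m (leq_maxl _ _); have := hN' m (leq_maxr _ _).
  move=> /ltW hm em; rewrite lerBlDr fctE.
  apply: le_trans (hnorm_triangle (T m x) _ _) _.
  apply: le_trans (lerD (cT n m x) hm) _.
  have : e m * hnorm x <= d * hnorm x by rewrite ler_wpM2r ?hnorm_ge0.
  lra.
exists T'; split=> // a x y; apply/eqP; rewrite -subr_eq0; apply/eqP/hnorm_eq0/le_anti.
rewrite hnorm_ge0 andbT.
apply: (@le0_of_small _ _ (hnorm (a *: x + y) + (normc a * hnorm x + hnorm y))) => d d0.
have [N /(_ N (leqnn N)) hN] := null_le e0 d0.
have {}bT z : hnorm (T N z - T' z) <= d * hnorm z.
  by rewrite (le_trans (bT' N z))// ler_wpM2r ?hnorm_ge0.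
(* B is small but not yet known to be linear; linearity of T N reduces the defect of T' to three
   values of B. *)
pose B z := T N z - T' z.
have E z : T' z = T N z - B z by rewrite /B subKr.
have -> : T' (a *: x + y) - (a *: T' x + T' y) = (a *: B x + B y) - B (a *: x + y).
  rewrite !E lT scalerBr addrACA -opprD [- (_ + _ - _)]opprB [LHS]addrC.
  by rewrite [LHS]addrA subrK.
apply: le_trans (le_hnormB _ _) _; rewrite mulrDl [leLHS]addrC.
apply: lerD; first by rewrite mulrC; exact: bT.
apply: le_trans (le_hnormD _ _) _; rewrite mulrDl hnormZ.
apply: lerD; last by rewrite mulrC; exact: bT.
by rewrite -mulrA ler_wpM2l ?normc_ge0// mulrC; exact: bT.
Qed.

Lemma op_bound_eq (R : realType) (H : hilbertType R) (T T' : H -> H) (C : R) :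
  (forall d, 0 < d -> op_bound (T - T') (C * d)) -> T = T'.
Proof.
move=> h; apply/funext => x; apply/eqP; rewrite -subr_eq0.
apply/eqP/hnorm_eq0/le_anti; rewrite hnorm_ge0 andbT.
by apply: (@le0_of_small _ _ (C * hnorm x)) => d d0; rewrite mulrAC; exact: h.
Qed.

Lemma adjoint_limit (R : realType) (H : hilbertType R) (T S : H -> H) (C : R) :
  (forall d, 0 < d -> exists T' S',
     [/\ adjoint T' S', op_bound (T - T') (C * d) & op_bound (S - S') (C * d)]) ->
  adjoint T S.
Proof.
move=> h x y; apply/eqP; rewrite -subr_eq0; apply/eqP/eq0_normc/le_anti.
rewrite normc_ge0 andbT; apply: (@le0_of_small _ _ (2 * C * hnorm x * hnorm y)) => d d0.
have [T' [S' [ad hT hS]]] := h d d0.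
have -> : inner (T x) y - inner x (S y) =
    inner ((T - T') x) y - inner x ((S - S') y).
  by rewrite !fctE innerBl innerBr ad; ring.
apply: le_trans (le_normcD _ _) _; rewrite normcN.
apply: le_trans (lerD (cauchy_schwarz _ _) (cauchy_schwarz _ _)) _.
have hT' : hnorm ((T - T') x) * hnorm y <= C * d * hnorm x * hnorm y.
  by rewrite ler_wpM2r ?hnorm_ge0.
have hS' : hnorm x * hnorm ((S - S') y) <= hnorm x * (C * d * hnorm y).
  by rewrite ler_wpM2l ?hnorm_ge0.
lra.
Qed.

(** Real and imaginary parts converge separately, each within e n; the factor 2 is a convenient
    bound for the square root of 2. *)
Lemma complex_limit (R : realType) (u : nat -> R[i]) (e : nat -> R) :
  (forall m n, normc (u m - u n) <= e m + e n) -> e @ \oo --> (0 : R) ->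
  exists l, forall n, normc (u n - l) <= 2 * e n.
Proof.
move=> cu e0.
have real_limit (v : nat -> R) : (forall m n, `|v m - v n| <= e m + e n) ->
    exists l, forall n, `|v n - l| <= e n.
  move=> cv; have : cvgn v.
    apply/cauchy_cvgP/cauchy_exP => d d0.
    have d4 : 0 < d / 4 by rewrite divr_gt0.
    have [N hN] := null_le e0 d4; exists (v N), N => // n /= Nn; rewrite /ball /=.
    apply: le_lt_trans (cv N n) _; have := hN N (leqnn N); have := hN n Nn; lra.
  move=> /cvg_ex[l hl]; exists l => n; rewrite -subr_le0.
  apply: (@le0_of_small _ _ 2) => d d0.
  have [N hN] := null_le e0 d0; have /cvgrPdist_le/(_ d d0)[N' _ hN'] := hl.
  have := hN _ (leq_maxl N N'); have := hN' _ (leq_maxr N N').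
  have := cv n (maxn N N'); set m := maxn N N' => h1 /= h2 h3.
  rewrite lerBlDr (_ : v n - l = (v n - v m) - (l - v m)); last by ring.
  apply: le_trans (ler_normB _ _) _; lra.
have [r hr] : exists l, forall n, `|complex.Re (u n) - l| <= e n.
  by apply: real_limit => m n; rewrite -ReN -ReD (le_trans (Re_le_normc _)).
have [s hs] : exists l, forall n, `|complex.Im (u n) - l| <= e n.
  by apply: real_limit => m n; rewrite -ImN -ImD (le_trans (Im_le_normc _)).
exists (r +i* s) => n; have en : 0 <= e n := le_trans (normr_ge0 _) (hr n).
rewrite -ler_sqr ?nnegrE ?normc_ge0 ?mulr_ge0// sqr_normcE !(ReD, ReN, ImD, ImN) /=.
apply: (@le_trans _ _ (e n ^+ 2 + e n ^+ 2)).
  by rewrite lerD// -[leLHS]real_normK ?num_real// ler_sqr ?nnegrE.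
rewrite exprMn; have := sqr_ge0 (e n); lra.
Qed.

(** * The correspondence with operators on H *)

Lemma cstar_lin (R : realType) (H : hilbertType R) (A : set (H -> H)) (c : R[i]) S T :
  cstar_subalgebra A ->
  A S -> A T -> A (c *: S + T).
Proof. by move=> [[_ _ AD AZ _] _] AS AT; apply: AD => //; exact: AZ. Qed.

Lemma mx_boundN (R : realType) n (M : 'M[R[i]]_n) C : mx_bound M C -> mx_bound (- M) C.
Proof.
move=> MC v; rewrite mulNmx; apply: le_trans (MC v).
by rewrite /vnormsq ler_sum// => i _; rewrite mxE normcN.
Qed.

Lemma mx_bound_le (R : realType) n (M : 'M[R[i]]_n) C D : 0 <= C -> C <= D ->
  mx_bound M C -> mx_bound M D.
Proof.
move=> C0 CD MC v; apply: le_trans (MC v) _.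
by rewrite ler_wpM2r ?vnormsq_ge0// ler_sqr ?nnegrE// (le_trans C0).
Qed.

Section Correspondence.
Context {R : realType} {p q : nat} {H : hilbertType R}.
Hypothesis q_gt0 : (0 < q)%N.
Variables (A : set (H -> H)) (U V Ui Vi : H -> H).
Hypotheses (cA : cstar_subalgebra A) (AU : A U) (AV : A V).
Hypotheses (UUi : adjoint U Ui) (VVi : adjoint V Vi).
Hypotheses (UK : cancel U Ui) (UiK : cancel Ui U) (VK : cancel V Vi) (ViK : cancel Vi V).
Hypothesis UV : U \o V = omega R p q *: (V \o U).

Let linUi : linear Ui. Proof. exact: adjoint_linear UUi. Qed.
Let linVi : linear Vi. Proof. exact: adjoint_linear VVi. Qed.
Let U_iso x y : inner (U x) (U y) = inner x y. Proof. by rewrite UUi UK. Qed.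
Let V_iso x y : inner (V x) (V y) = inner x y. Proof. by rewrite VVi VK. Qed.
Let Ui_iso x y : inner (Ui x) (Ui y) = inner x y. Proof. by rewrite -UUi UiK. Qed.
Let Vi_iso x y : inner (Vi x) (Vi y) = inner x y. Proof. by rewrite -VVi ViK. Qed.

(** The graph of the homomorphism. It stays a relation because T does not come with a symbol;
    [corresponds_unique] shows that it is single-valued. *)
Definition corresponds T T1 := exists a : R * R -> 'M[R[i]]_q,
  [/\ regular_symbol a, T = mulop a, A T1 & intertwines Ui Vi a T1].

Lemma A_bounded T1 : A T1 -> bounded_op T1.
Proof. by have [[h _ _ _ _] _] := cA; exact: h. Qed.

Lemma corresponds_bounded T T1 : corresponds T T1 -> bounded_op T.
Proof.
move=> [a [ga -> _ _]]; have [C C0 aC] := regular_symbol_bounded ga.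
by apply: (@op_bound_bounded _ _ _ C); [exact: mulop_linear|exact: mulop_bound].
Qed.

Lemma corresponds_lin (c : R[i]) S S1 T T1 : corresponds S S1 -> corresponds T T1 ->
  corresponds (c *: S + T) (c *: S1 + T1).
Proof.
move=> [a [ga -> AS aS]] [b [gb -> AT bT]]; exists (fun x => c *: a x + b x).
split; [exact: regular_symbol_lin|by rewrite mulop_lin2|exact: cstar_lin|exact: intertwines_lin].
Qed.

Lemma corresponds0 : corresponds 0 0.
Proof.
have [[_ A0 _ _ _] _] := cA; exists (fun=> 0); split=> //.
- exact: regular_symbol_cst.
- by rewrite mulop0.
- move=> xi; apply: (@squeeze0 _ _ (fun=> 0)); last exact: cvg_cst.
  move=> n; rewrite hnorm_ge0 /= -[X in X <= _]/(hnorm _).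
  have -> : (0 : H -> H) xi = 0 by [].
  have -> : embed Ui Vi n 0 = 0 :> hfun (@grid q n) H.
    by have := embedB linUi linVi n 0 0 (q := q); rewrite !subrr.
  rewrite subr0 (_ : act _ _ = 0) ?hnorm0//.
  by apply/ffunP => x; rewrite !ffunE big1// => j _; rewrite mxE scale0r.
Qed.

Lemma corresponds_add S S1 T T1 : corresponds S S1 -> corresponds T T1 ->
  corresponds (S + T) (S1 + T1).
Proof. by move=> hS /(corresponds_lin 1 hS); rewrite !scale1r. Qed.

Lemma corresponds_scale (c : R[i]) T T1 : corresponds T T1 ->
  corresponds (c *: T) (c *: T1).
Proof. by move=> /(corresponds_lin c)/(_ corresponds0); rewrite !addr0. Qed.

Lemma corresponds_comp S S1 T T1 : corresponds S S1 -> corresponds T T1 ->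
  corresponds (S \o T) (S1 \o T1).
Proof.
move=> [a [ga -> AS aS]] [b [gb -> AT bT]]; exists (fun x => a x *m b x).
have [C C0 aC] := regular_symbol_bounded ga.
have [[_ _ _ _ AM] _] := cA.
split; [exact: regular_symbolM|by rewrite mulopM|exact: AM|exact: intertwinesM C0 aC aS bT].
Qed.

(** Contractivity, with the pointwise norm of the symbol as the intermediary. Both single-valuedness
    and the passage to limits rest on it. *)
Lemma corresponds_bound T T1 C : corresponds T T1 -> 0 <= C -> op_bound T C ->
  op_bound T1 C.
Proof.
move=> [a [ga -> _ aT]] C0 /(mulop_bound_pointwise ga C0) aC.
exact: intertwines_bound aC aT.
Qed.

Lemma corresponds_sub S S1 T T1 : corresponds S S1 -> corresponds T T1 ->
  corresponds (S - T) (S1 - T1).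
Proof.
move=> hS hT; rewrite addrC -scaleN1r [S1 - T1]addrC -[- T1]scaleN1r.
exact: corresponds_lin.
Qed.

Lemma corresponds_unique T T1 T1' : corresponds T T1 -> corresponds T T1' -> T1 = T1'.
Proof.
move=> h h'; have := corresponds_sub h h'; rewrite subrr => /corresponds_bound h0.
apply/funext => x; apply/eqP; rewrite -subr_eq0; apply/eqP/hnorm_eq0/le_anti.
rewrite hnorm_ge0 andbT -(mul0r (hnorm x)); apply: h0 => // y.
by rewrite mul0r (_ : (0 : Hq R q -> Hq R q) y = 0)// hnorm0.
Qed.

(** The difference of the symbols multiplies by zero, so at every point it is bounded by every e >
    0, and [intertwines_limit] applies with a and T1 as the approximants. It serves to replace the
    symbol of an adjoint operator by the adjoint symbol. *)
Lemma intertwines_mulop (a b : R * R -> 'M[R[i]]_q) T1 : regular_symbol a -> regular_symbol b ->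
  mulop a = mulop b :> (Hq R q -> Hq R q) -> intertwines Ui Vi a T1 -> intertwines Ui Vi b T1.
Proof.
move=> ga gb ab aT; apply: intertwines_limit => // e e0; exists a, T1; split=> //.
  apply: (mulop_bound_pointwise (regular_symbolB gb ga) (ltW e0)) => v.
  rewrite mulopB// ab subrr (_ : (0 : Hq R q -> Hq R q) v = 0)// hnorm0.
  by rewrite mulr_ge0 ?hnorm_ge0 ?ltW.
by move=> x; rewrite subrr (_ : (0 : H -> H) x = 0)// hnorm0 mulr_ge0 ?hnorm_ge0 ?ltW.
Qed.

Lemma corresponds_adjoint T T1 S S1 : corresponds T T1 -> corresponds S S1 ->
  adjoint T S -> adjoint T1 S1.
Proof.
move=> [a [ga -> _ aT]] [b [gb -> _ bS]] ad.
apply: (intertwines_adjoint q_gt0 Ui_iso Vi_iso aT).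
apply: (intertwines_mulop gb (regular_symbol_adj ga) _ bS).
exact: adjoint_unique ad (mulop_adjoint ga).
Qed.

(** Operator bounds on differences give pointwise matrix bounds, so the symbols are uniformly
    Cauchy; contractivity makes the T1 n Cauchy as well. The limit of the T n is built as
    multiplication by the limit symbol, so it has a regular symbol by construction. *)
Lemma corresponds_limit (T : nat -> Hq R q -> Hq R q) (T1 : nat -> H -> H) (e : nat -> R) :
  (forall n, corresponds (T n) (T1 n)) ->
  (forall m n, op_bound (T m - T n) (e m + e n)) -> (forall n, 0 <= e n) ->
  e @ \oo --> (0 : R) ->
  exists T' T1' K, corresponds T' T1' /\ forall n, op_bound (T n - T') (K * e n).
Proof.
move=> cT Te e0 e_cvg.
have cT1 m n : op_bound (T1 m - T1 n) (e m + e n).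
  by apply: corresponds_bound (corresponds_sub (cT m) (cT n)) _ (Te m n); exact: addr_ge0.
have /choice[a ha] : forall n, exists a : R * R -> 'M[R[i]]_q,
  [/\ regular_symbol a, T n = mulop a, A (T1 n) & intertwines Ui Vi a (T1 n)] := cT.
have ga n : regular_symbol (a n) by have [] := ha n.
have TE n : T n = mulop (a n) by have [] := ha n.
have [T1' [lT1' hT1']] : exists T1', linear T1' /\ forall n, op_bound (T1 n - T1') (e n).
  apply: operator_limit => // n; have [_ _ AT _] := ha n.
  by have [] := A_bounded AT.
have bnd m n x : mx_bound (a m x - a n x) (e m + e n).
  apply: (mulop_bound_pointwise (regular_symbolB (ga m) (ga n))); first exact: addr_ge0.
  by rewrite mulopB// -!TE.
have /choice[b0 hb0] : forall xij : (R * R) * ('I_q * 'I_q), exists l,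
    forall n, normc (a n xij.1 xij.2.1 xij.2.2 - l) <= 2 * e n.
  move=> [x [i j]]; apply: complex_limit => // m n /=.
  have := mx_bound_entry (addr_ge0 (e0 m) (e0 n)) (bnd m n x) i j.
  by rewrite !mxE.
pose b (x : R * R) : 'M[R[i]]_q := \matrix_(i, j) b0 (x, (i, j)).
have hb n x i j : normc (a n x i j - b x i j) <= 2 * e n.
  by rewrite mxE; exact: hb0 (x, (i, j)) n.
have e2 : (fun n => 2 * e n) @ \oo --> (0 : R).
  by rewrite -[X in _ --> X](mulr0 2); apply: cvgMr.
have gb : regular_symbol b.
  move=> i j; apply: (@regular_cfun_lim _ _ (fun n x => a n x i j) _ _ (fun n => ga n i j) _ e2) => n x.
  exact: hb.
(* The 2 comes from [complex_limit], the two factors q from [mx_bound_entries]. *)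
pose K : R := q%:R * (q%:R * 2).
have K0 : 0 <= K by rewrite !mulr_ge0.
have abK n x : mx_bound (a n x - b x) (K * e n).
  rewrite /K -!mulrA; apply: mx_bound_entries; first by rewrite mulr_ge0.
  by move=> i j; have := hb n x i j; rewrite !mxE.
exists (mulop b), T1', K; split.
  have T1'b : bounded_op T1'.
    have [_ _ AT _] := ha 0%N; have [_ [C hC]] := A_bounded AT.
    split=> //; exists (C + e 0%N) => x.
    rewrite -[T1' x](subKr (T1 0%N x)) mulrDl; apply: le_trans (le_hnormB _ _) _.
    by apply: lerD; [exact: hC|exact: hT1'].
  exists b; split=> //.
    have [_ [_ Acl]] := cA; apply: Acl => // d d0.
    have d2 : 0 < d / 2 by rewrite divr_gt0.
    have [N /(_ N (leqnn N)) hN] := null_le e_cvg d2.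
    exists (T1 N); first by have [] := ha N.
    apply: (@le_lt_trans _ _ (e N)); last by rewrite (le_lt_trans hN)// ltr_pdivrMr// ltr_pMr// ltr1n.
    by apply: opnorm_le => // x; rewrite fctE hnormBC; exact: hT1'.
  apply: intertwines_limit => // d d0.
  have K1 : 0 < K + 1 by rewrite ltr_wpDl.
  have dK : 0 < d / (K + 1) by rewrite divr_gt0.
  have [N /(_ N (leqnn N)) hN] := null_le e_cvg dK.
  have eN : (K + 1) * e N <= d by rewrite mulrC -ler_pdivlMr.
  exists (a N), (T1 N); split; first by have [] := ha N.
    move=> x; rewrite -opprB; apply/mx_boundN/(mx_bound_le _ _ (abK N x)).
      by rewrite mulr_ge0.
    by apply: le_trans eN; rewrite mulrDl mul1r lerDl.
  move=> x; rewrite fctE hnormBC; apply: le_trans (hT1' N x) _.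
  rewrite ler_wpM2r ?hnorm_ge0//; apply: le_trans eN.
  by rewrite mulrDl mul1r lerDr mulr_ge0.
move=> n; rewrite TE -mulopB//; apply: mulop_bound => //; first exact: regular_symbolB.
by rewrite mulr_ge0.
Qed.

Lemma A_adjoint T1 S1 : A T1 -> adjoint T1 S1 -> A S1.
Proof. by have [_ [h _]] := cA; exact: h. Qed.

(** Supplies the adjoint half of membership in [corr_domain] for the two generators. *)
Lemma corresponds_inverse (a : R * R -> 'M[R[i]]_q) T1 S1 : regular_symbol a -> A S1 ->
  (forall x, mxadj (a x) *m a x = 1%:M) -> cancel S1 T1 ->
  intertwines Ui Vi a T1 -> corresponds (mulop (@mxadj R q \o a)) S1.
Proof.
move=> ga AS aa ST aT; have [C C0 aC] := regular_symbol_bounded (regular_symbol_adj ga).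
exists (@mxadj R q \o a); split; [exact: regular_symbol_adj|by []|by []|].
exact: (intertwines_inverse C0 aC aa ST aT).
Qed.

Lemma intertwines_symbolU : intertwines Ui Vi (@symbolU R q) U.
Proof. exact: intertwines_U. Qed.

Lemma intertwines_symbolV : intertwines Ui Vi (@symbolV R p q) V.
Proof.
apply: (@intertwines_V _ _ _ U V Ui Vi (omega R p q)) => //; first exact: omega_order.
by move=> x; have := congr1 (fun F => F x) UV.
Qed.

(* The pair (S, S1) records that T and T1 have adjoints that correspond again. *)
Definition corr_domain : set (Hq R q -> Hq R q) := [set T | exists T1 S S1,
  [/\ corresponds T T1, adjoint T S & corresponds S S1]].

Lemma corresponds_U : corresponds (Uq R q) U.
Proof.
by exists (@symbolU R q); split; [exact: regular_symbolU| | |exact: intertwines_symbolU].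
Qed.

Lemma corresponds_V : corresponds (Vq R p q) V.
Proof.
by exists (@symbolV R p q); split; [exact: regular_symbolV| | |exact: intertwines_symbolV].
Qed.

Lemma corr_domain_U : corr_domain (Uq R q).
Proof.
have gU : regular_symbol (@symbolU R q) by exact: regular_symbolU.
exists U, (mulop (@mxadj R q \o @symbolU R q)), Ui; split.
- exact: corresponds_U.
- exact: (mulop_adjoint gU).
- exact: (corresponds_inverse gU (A_adjoint AU UUi) (@symbolU_unitary R q) UiK
    intertwines_symbolU).
Qed.

Lemma corr_domain_V : corr_domain (Vq R p q).
Proof.
have gV : regular_symbol (@symbolV R p q) by exact: regular_symbolV.
exists V, (mulop (@mxadj R q \o @symbolV R p q)), Vi; split.
- exact: corresponds_V.
- exact: (mulop_adjoint gV).
- exact: (corresponds_inverse gV (A_adjoint AV VVi) (@symbolV_unitary R p q) ViK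
    intertwines_symbolV).
Qed.

Lemma corr_domain_Pq : corr_domain `<=` @Pq R q.
Proof.
move=> T [T1 [_ [_ [[a [ga -> _ _]] _ _]]]]; exists a => //.
exact: regular_symbol_continuous.
Qed.

Lemma corr_domain_closed T : bounded_op T ->
  (forall e : R, 0 < e -> exists2 S, corr_domain S & opnorm (T - S) < e) -> corr_domain T.
Proof.
move=> bT hT; pose e n : R := harmonic n.
have e0 n : 0 <= e n by rewrite /e /harmonic /= invr_ge0.
have e_cvg : e @ \oo --> (0 : R) by exact: cvg_harmonic.
(* A single choice delivers each approximant with its partner, its adjoint and the partner of the
   adjoint, so that the two limits taken below remain linked. *)
have /choice[F hF] : forall n, exists F : (Hq R q -> Hq R q) * (H -> H) *
    ((Hq R q -> Hq R q) * (H -> H)),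
    [/\ corresponds F.1.1 F.1.2, adjoint F.1.1 F.2.1, corresponds F.2.1 F.2.2
      & op_bound (T - F.1.1) (e n)].
  move=> n; have en : 0 < e n by rewrite /e /harmonic /= invr_gt0.
  have [T' [T1 [S [S1 [cT ad cS]]]] lt] := hT _ en; exists ((T', T1), (S, S1)); split=> //.
  move=> x; apply: le_trans (opnorm_bound _ _) _.
    exact: (bounded_opB bT (corresponds_bounded cT)).
  by rewrite ler_wpM2r ?hnorm_ge0// ltW.
have TT m n : op_bound ((F m).1.1 - (F n).1.1) (e m + e n).
  move=> x; rewrite fctE mulrDl; apply: le_trans (hnorm_triangle (T x) _ _) _.
  have [_ _ _ hm] := hF m; have [_ _ _ hn] := hF n.
  by apply: lerD; [rewrite hnormBC; exact: hm|exact: hn].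
(* Adjoints obey the same bounds, so the adjoint sequence is Cauchy at the same rate. *)
have SS m n : op_bound ((F m).2.1 - (F n).2.1) (e m + e n).
  apply: adjoint_bound (TT m n) => x y; rewrite !fctE innerBl innerBr.
  by have [_ hm _ _] := hF m; have [_ hn _ _] := hF n; rewrite hm hn.
have cT n : corresponds (F n).1.1 (F n).1.2 by have [] := hF n.
have cS n : corresponds (F n).2.1 (F n).2.2 by have [] := hF n.
have [T' [T1' [K [cT' hT']]]] := corresponds_limit cT TT e0 e_cvg.
have [S' [S1' [L [cS' hS']]]] := corresponds_limit cS SS e0 e_cvg.
have small d : 0 < d -> exists n, e n <= d.
  by move=> d0; have [N hN] := null_le e_cvg d0; exists N; exact: hN.
have K0 : 0 <= `|K| := normr_ge0 K; have L0 : 0 <= `|L| := normr_ge0 L.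
(* [corresponds_limit] produces its own limit; it equals T because both are limits of the same
   approximants. *)
have E : T = T'.
  apply: (@op_bound_eq _ _ _ _ (1 + `|K|)) => d d0 x; have [n en] := small d d0.
  have [_ _ _ hn] := hF n; rewrite fctE.
  apply: le_trans (hnorm_triangle ((F n).1.1 x) _ _) _.
  apply: le_trans (lerD (hn x) (hT' n x)) _.
  rewrite -mulrDl ler_wpM2r ?hnorm_ge0// mulrDl mul1r lerD//.
  by apply: le_trans (ler_wpM2r (e0 n) (ler_norm K)) _; rewrite ler_wpM2l.
exists T1', S', S1'; split=> //; first by rewrite E.
apply: (@adjoint_limit _ _ _ _ (1 + `|L|)) => d d0; have [n en] := small d d0.
have [_ ad _ hn] := hF n; exists (F n).1.1, (F n).2.1; split=> // x.
  apply: le_trans (hn x) _; rewrite ler_wpM2r ?hnorm_ge0// mulrDl mul1r.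
  by rewrite (le_trans en)// lerDl mulr_ge0// ltW.
rewrite fctE hnormBC; apply: le_trans (hS' n x) _; rewrite ler_wpM2r ?hnorm_ge0//.
apply: le_trans (ler_wpM2r (e0 n) (ler_norm L)) _.
apply: (@le_trans _ _ (`|L| * d)); first by rewrite ler_wpM2l.
by rewrite mulrDl mul1r lerDr ltW.
Qed.

Lemma corr_domain_cstar : cstar_subalgebra corr_domain.
Proof.
have DZ (c : R[i]) S T : corr_domain S -> corr_domain T -> corr_domain (c *: S + T).
  move=> [S1 [S' [S1' [cS aS cS']]]] [T1 [T' [T1' [cT aT cT']]]].
  exists (c *: S1 + T1), (c^*%C *: S' + T'), (c^*%C *: S1' + T1').
  split; [exact: corresponds_lin| |exact: corresponds_lin] => x y.
  by rewrite !fctE innerDl innerZl innerDr innerZr conjcK aS aT.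
have D0 : corr_domain 0.
  exists 0, 0, 0; split; [exact: corresponds0| |exact: corresponds0] => x y.
  by rewrite inner0l inner0r.
split; split.
- by move=> T [T1 [_ [_ [h _ _]]]]; exact: corresponds_bounded h.
- exact: D0.
- by move=> S T hS hT; rewrite -[S]scale1r; exact: DZ.
- by move=> c T hT; rewrite -[c *: T]addr0; exact: DZ.
- move=> S T [S1 [S' [S1' [cS aS cS']]]] [T1 [T' [T1' [cT aT cT']]]].
  exists (S1 \o T1), (T' \o S'), (T1' \o S1').
  split; [exact: corresponds_comp| |exact: corresponds_comp] => x y.
  by rewrite /= aS aT.
- move=> T S [T1 [S' [S1 [cT aT cS]]]] aTS; rewrite (adjoint_unique aTS aT).
  by exists S1, T, T1; split=> //; exact: adjoint_sym.
- exact: corr_domain_closed.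
Qed.

Lemma rotation_algebra_corr_domain : rotation_algebra R p q `<=` corr_domain.
Proof.
move=> T hT; apply: hT; split.
  by split; [exact: corr_domain_cstar|exact: corr_domain_Pq].
by move=> _ [->|->]; [exact: corr_domain_U|exact: corr_domain_V].
Qed.

Lemma rotation_algebra_hom : exists Psi,
  [/\ star_homomorphism (rotation_algebra R p q) A Psi, Psi (Uq R q) = U
    & Psi (Vq R p q) = V].
Proof.
(* The default 0 is taken only where T has no partner, hence not on the rotation algebra. *)
pose Psi T := xget (0 : H -> H) [set T1 | corresponds T T1].
have PsiP T T1 : corresponds T T1 -> Psi T = T1.
  move=> h; apply: (corresponds_unique _ h).
  by apply: (@xgetPex _ 0 [set T1 | corresponds T T1]); exists T1.
have rotP T : rotation_algebra R p q T -> corresponds T (Psi T).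
  move=> /rotation_algebra_corr_domain[T1 [_ [_ [h _ _]]]].
  by rewrite (PsiP _ _ h).
exists Psi; split.
- split.
  + by move=> T /rotP[a []].
  + by move=> S T /rotP hS /rotP hT; exact/PsiP/corresponds_add.
  + by move=> c T /rotP hT; exact/PsiP/corresponds_scale.
  + by move=> S T /rotP hS /rotP hT; exact/PsiP/corresponds_comp.
  (* The partner of S is read off the adjoint pair stored with T, adjoints being unique. *)
  + move=> T S hT aTS; have [T1 [S' [S1 [cT aT cS]]]] := rotation_algebra_corr_domain hT.
    rewrite (PsiP _ _ cT) (adjoint_unique aTS aT) (PsiP _ _ cS).
    exact: corresponds_adjoint cT cS aT.
- exact/PsiP/corresponds_U.
- exact/PsiP/corresponds_V.
Qed.

End Correspondence.

(** * Membership in the class and the universal property *)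

Lemma Uq_unitary (R : realType) (q : nat) : (0 < q)%N -> unitary_op (Uq R q).
Proof.
by move=> q0; apply: (mulop_unitary (regular_symbolU q0)); exact: symbolU_unitary.
Qed.

Lemma Vq_unitary (R : realType) (p q : nat) : (0 < q)%N -> unitary_op (Vq R p q).
Proof.
by move=> q0; apply: (mulop_unitary (regular_symbolV (p := p) q0)); exact: symbolV_unitary.
Qed.

Lemma UqVq_commutation (R : realType) (p q : nat) : (0 < q)%N ->
  Uq R q \o Vq R p q = omega R p q *: (Vq R p q \o Uq R q).
Proof.
move=> q0.
have gU : regular_symbol (@symbolU R q) := regular_symbolU q0.
have gV : regular_symbol (@symbolV R p q) := regular_symbolV q0.
rewrite -[LHS](mulopM gU gV) -[Vq R p q \o _](mulopM gV gU).
rewrite -[RHS]addr0 -mulop0 -mulop_lin2; [|exact: regular_symbolM|exact: regular_symbol_cst].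
by congr mulop; apply/funext => x; rewrite symbol_commutation// addr0.
Qed.

(** What has to be seen is that the C*-algebra generated by the pair inside all bounded operators
    lies in [Pq]. Taking H to be [Hq], with all bounded operators as the algebra A and the
    generators themselves as U and V, the domain of the correspondence is a C*-algebra inside [Pq]
    containing the pair. *)
Lemma rotation_algebra_generated (R : realType) (p q : nat) : (0 < q)%N ->
  rotation_algebra R p q = cstar_generated [set Uq R q; Vq R p q].
Proof.
move=> q0.
have [bU [Ui [UUi UUiK UiUK]]] := Uq_unitary R q0.
have [bV [Vi [VVi VViK ViVK]]] := Vq_unitary R p q0.
have bUV : [set Uq R q; Vq R p q] `<=` @bounded_op R (Hq R q) by move=> _ [->|->].
have UK : cancel (Uq R q) Ui by move=> x; exact: (congr1 (fun F => F x) UiUK).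
have UiK : cancel Ui (Uq R q) by move=> x; exact: (congr1 (fun F => F x) UUiK).
have VK : cancel (Vq R p q) Vi by move=> x; exact: (congr1 (fun F => F x) ViVK).
have ViK : cancel Vi (Vq R p q) by move=> x; exact: (congr1 (fun F => F x) VViK).
have UV := UqVq_commutation R p q0.
pose D := corr_domain (q := q) (@bounded_op R (Hq R q)) Ui Vi.
have cD : cstar_subalgebra D.
  exact: (corr_domain_cstar q0 bounded_op_cstar UUi VVi UiK ViK).
have DU : D (Uq R q) by exact: (corr_domain_U q0 bounded_op_cstar bU UUi VVi UK UiK ViK).
have DV : D (Vq R p q).
  exact: (corr_domain_V q0 bounded_op_cstar bV UUi VVi UK UiK VK ViK UV).
apply/seteqP; split.
  move=> T hT; apply: hT; split; last by move=> X XUV B [_ XB]; exact: XB.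
  split; first exact: cstar_generated_cstar.
  move=> X hX; have : D X by apply: hX; split=> // _ [->|->].
  exact: corr_domain_Pq.
by move=> T hT B [[cB _] BUV]; exact: hT.
Qed.

Theorem theorem3 (R : realType) (p q : nat)
    (p_bounds : (1 <= p <= q - 1)%N) (pq_coprime : gcdn p q = 1%N) :
  rotation_class (omega R p q) (rotation_algebra R p q) /\
  forall (H1 : hilbertType R) (A1 : set (H1 -> H1)) (U1 V1 : H1 -> H1),
    generating_pair (omega R p q) A1 U1 V1 ->
    exists Psi : (Hq R q -> Hq R q) -> (H1 -> H1),
      [/\ star_homomorphism (rotation_algebra R p q) A1 Psi,
          Psi (Uq R q) = U1 & Psi (Vq R p q) = V1].
Proof.
have q0 : (0 < q)%N by case/andP: p_bounds => + /leq_trans/(_ (leq_subr _ _)); exact: leq_trans.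
split.
  exists (Uq R q), (Vq R p q); split; [exact: Uq_unitary|exact: Vq_unitary| |].
    exact: UqVq_commutation.
  exact: rotation_algebra_generated.
move=> H1 A1 U1 V1 [[bU [Ui [UUi UUiK UiUK]]] [bV [Vi [VVi VViK ViVK]]] UV ->].
have bUV : [set U1; V1] `<=` @bounded_op R H1 by move=> _ [->|->].
apply: (@rotation_algebra_hom R p q H1 q0 _ U1 V1 Ui Vi) => //.
- exact: cstar_generated_cstar.
- by move=> B [_ UVB]; apply: UVB; left.
- by move=> B [_ UVB]; apply: UVB; right.
- by move=> x; exact: (congr1 (fun F => F x) UiUK).
- by move=> x; exact: (congr1 (fun F => F x) UUiK).
- by move=> x; exact: (congr1 (fun F => F x) ViVK).
- by move=> x; exact: (congr1 (fun F => F x) VViK).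
Qed.
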